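(* Let $k,l\ge 2$ and let $n=n_1+\dots+n_k=m_1+\dots+m_l$ be two partitions of $n$ into positive integers. Let $G=U(n)$, let $L=U(n_1)\times U(n_2)\times\cdots\times U(n_k)$ and $H=U(m_1)\times\cdots\times U(m_l)$ be the natural block-diagonal subgroups of $G$, and let $G'=O(n)\subset U(n)$. Put $N:=\min(n_1,\dots,n_k)$ and $M:=\min(m_1,\dots,m_l)$. Then the following five conditions are equivalent: (i) $G=LG'H$, i.e. the multiplication map $L\times G'\times H\to G$, $(x,g,h)\mapsto xgh$, is surjective. (ii) $\mathcal{B}_{m_1,\dots,m_l}(\mathbb{R}^n)\times\mathcal{B}_{n_1,\dots,n_k}(\mathbb{R}^n)$ meets every $G$-orbit of the diagonal $G$-action on $\mathcal{B}_{m_1,\dots,m_l}(\mathbb{C}^n)\times\mathcal{B}_{n_1,\dots,n_k}(\mathbb{C}^n)$. (ii)$'$ $\mathcal{B}_{m_1,\dots,m_l}(\mathbb{R}^n)$ meets every $L$-orbit on $\mathcal{B}_{m_1,\dots,m_l}(\mathbb{C}^n)$. (ii)$''$ $\mathcal{B}_{n_1,\dots,n_k}(\mathbb{R}^n)$ meets every $H$-orbit on $\mathcal{B}_{n_1,\dots,n_k}(\mathbb{C}^n)$. (iii) One of the following holds: 0) $k=2$ and $l=2$; I) $k=3$, $N=1$, $l=2$; II) $k=3$, $N\ge 2$, $l=2$, $M=2$; III) $l=2$, $M=1$; I$'$) $k=2$, $l=3$, $M=1$; II$'$) $k=2$, $N=2$, $l=3$, $M\ge 2$; III$'$) $k=2$,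 $N=1$.
   Context: For a partition $n=m_1+\dots+m_l$ into positive integers, the complex generalized flag variety $\mathcal{B}_{m_1,\dots,m_l}(\mathbb{C}^n)$ is the set of flags $(V_1,\dots,V_l)$ of complex subspaces $\{0\}=V_0\subset V_1\subset\cdots\subset V_l=\mathbb{C}^n$ with $\dim V_i=m_1+\dots+m_i$ for $1\le i\le l$; $U(n)$ acts on it naturally. The real generalized flag variety $\mathcal{B}_{m_1,\dots,m_l}(\mathbb{R}^n)$ is defined likewise with real subspaces of $\mathbb{R}^n$, and is regarded as the (totally real) submanifold of $\mathcal{B}_{m_1,\dots,m_l}(\mathbb{C}^n)$ consisting of complexifications of real flags. Note $G/H\simeq\mathcal{B}_{m_1,\dots,m_l}(\mathbb{C}^n)$ and $G'/(G'\cap H)\simeq\mathcal{B}_{m_1,\dots,m_l}(\mathbb{R}^n)$. *)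

(* Defs.v *)
From HB Require Import structures.
From mathcomp Require Import all_boot all_order all_algebra spectral.
From mathcomp Require Import complex.
From mathcomp Require Import reals.
Set Implicit Arguments. Unset Strict Implicit. Unset Printing Implicit Defensive.
Import Order.TTheory GRing.Theory Num.Theory.
Local Open Scope ring_scope.

Definition Cx (R : realType) := (R[i])%type.

Section Defs.
Variable R : realType.
Local Notation C := (Cx R).

Definition orthmx n (A : 'M[C]_n) : bool := (A \is unitarymx) && (A \is a realmx).

Definition psums (s : seq nat) : seq nat :=
  [seq sumn (take j.+1 s) | j <- iota 0 (size s)].

Definition blk (s : seq nat) (i : nat) : nat := find (fun t => i < t)%N (psums s).

Definition blockU n (s : seq nat) (A : 'M[C]_n) : bool :=
  (A \is unitarymx) && [forall i : 'I_n, forall j : 'I_n, (blk s i != blk s j) ==> (A i j == 0)].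

Definition is_flag n (s : seq nat) (F : 'I_(size s) -> 'M[C]_n) : Prop :=
  (forall i : 'I_(size s), \rank (F i) = sumn (take i.+1 s)) /\
  (forall i j : 'I_(size s), (i <= j)%N -> (F i <= F j)%MS).

(* the flag is the complexification of a real flag: each V_i is spanned by
   real vectors *)
Definition is_real_flag n (s : seq nat) (F : 'I_(size s) -> 'M[C]_n) : Prop :=
  is_flag F /\ forall i : 'I_(size s), exists W : 'M[C]_n, (W \is a realmx) && (W == F i)%MS.

(* action of g in U(n) on a flag: V_i |-> g V_i (rows are vectors, so v |-> v g^T) *)
Definition flag_act n (s : seq nat) (g : 'M[C]_n) (F : 'I_(size s) -> 'M[C]_n) :
  'I_(size s) -> 'M[C]_n := fun i => F i *m g^T.

Definition flag_eq n (s : seq nat) (F F' : 'I_(size s) -> 'M[C]_n) : Prop :=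
  forall i, (F i == F' i)%MS.

End Defs.

Definition minpart (s : seq nat) : nat := foldr minn (head 0%N s) s.

(* Main.v *)
(** If [g = x o h] with [x] in L, [o] orthogonal and [h] in H, then conjugation
    by [x] makes the block projections of L and the [g]-conjugates of the block
    projections of H simultaneously real, so every word in them has real trace.
    Outside (iii) some unitary matrix with entries in Q(i), placed on suitable
    coordinates, violates this.

    Conversely let H have two blocks, one of them of size [m], and let the rows
    of [V] be an orthonormal basis of an [m]-dimensional subspace.  The
    compressions [V D_a V^*] of the block projections of L sum to the identity;
    in the cases of (iii) one change of basis makes all of them real.  The block
    components of the rows of [V] then have real Gram matrices, and vectors with
    a real Gram matrix can be rotated, inside their blocks, to real vectors. *)

Require Import Defs.
From Stdlib Require Import BinInt.
From HB Require Import structures.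
From mathcomp Require Import all_boot all_order all_algebra perm spectral.
From mathcomp Require Import complex.
From mathcomp Require Import reals zify ssrZ ring.
Set Implicit Arguments. Unset Strict Implicit. Unset Printing Implicit Defensive.
Import Order.TTheory GRing.Theory Num.Theory Num.Def.
Local Open Scope ring_scope.
Local Open Scope sesquilinear_scope.

(** * Real matrices, adjoints, and orthonormal bases adapted to subspaces *)

Section RealMatrices.
Variable C : numClosedFieldType.

Lemma realmxP m n (A : 'M[C]_(m, n)) : reflect (A ^ conjC = A) (A \is a realmx).
Proof.
apply: (iffP idP) => [/realmxC //|Ac]; apply/mxOverP => i j.
by apply/CrealP; rewrite -[in RHS]Ac mxE.
Qed.

Lemma realmxM m n p (A : 'M[C]_(m, n)) (B : 'M[C]_(n, p)) :
  A \is a realmx -> B \is a realmx -> A *m B \is a realmx.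
Proof. by move=> /realmxP Ar /realmxP Br; apply/realmxP; rewrite map_mxM Ar Br. Qed.

Lemma realmx_tr m n (A : 'M[C]_(m, n)) : A \is a realmx -> A^T \is a realmx.
Proof. by move=> /realmxP Ar; apply/realmxP; rewrite -map_trmx Ar. Qed.

Lemma realmx_trC m n (A : 'M[C]_(m, n)) : A \is a realmx -> A^t* = A^T.
Proof. by move=> /realmxP Ar; rewrite -map_trmx Ar. Qed.

Lemma realmx_row m n (A : 'M[C]_(m, n)) i : A \is a realmx -> row i A \is a realmx.
Proof. by move=> /realmxP Ar; apply/realmxP; rewrite map_row Ar. Qed.

Lemma realmx1 n : (1%:M : 'M[C]_n) \is a realmx.
Proof. by apply/realmxP; rewrite map_mx1. Qed.

Lemma realmx_pid m n r : (pid_mx r : 'M[C]_(m, n)) \is a realmx.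
Proof. by apply/realmxP; rewrite map_pid_mx. Qed.

Lemma realmx_ker m n (A : 'M[C]_(m, n)) : A \is a realmx -> kermx A \is a realmx.
Proof. by move=> /realmxP Ar; apply/realmxP; rewrite map_kermx Ar. Qed.

Lemma realmx_trace n (A : 'M[C]_n) : A \is a realmx -> \tr A \is Num.real.
Proof. by move=> /mxOverP Ar; apply: rpred_sum => i _; apply: Ar. Qed.

Lemma trmxC_mul m n p (A : 'M[C]_(m, n)) (B : 'M[C]_(n, p)) :
  (A *m B)^t* = B^t* *m A^t*.
Proof. by rewrite trmx_mul map_mxM. Qed.

Lemma trmxC_scale m n c (A : 'M[C]_(m, n)) : (c *: A)^t* = c^* *: A^t*.
Proof. by apply/matrixP => i j; rewrite !mxE rmorphM. Qed.

Lemma realmxZ m n c (A : 'M[C]_(m, n)) :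
  c \is Num.real -> A \is a realmx -> c *: A \is a realmx.
Proof. by move=> cr /mxOverP Ar; apply/mxOverP => i j; rewrite mxE rpredM. Qed.

Lemma unitarymx_trK n (A : 'M[C]_n) : A \is unitarymx -> A^t* *m A = 1%:M.
Proof. by rewrite -trmxC_unitary => /unitarymxP; rewrite trmxCK. Qed.

Lemma unitarymx_tr n (A : 'M[C]_n) : A \is unitarymx -> A^T \is unitarymx.
Proof. by rewrite trmx_unitary. Qed.

Lemma unitarymx_trC n (A : 'M[C]_n) : A \is unitarymx -> A^t* \is unitarymx.
Proof. by rewrite trmxC_unitary. Qed.

Lemma unitarymx1 n : (1%:M : 'M[C]_n) \is unitarymx.
Proof. by apply/unitarymxP; rewrite trmx1 map_mx1 mulmx1. Qed.

(* Gram-Schmidt inside prescribed subspaces; the rows stay real when the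
   subspaces are. *)
Lemma adapted_basis (b : bool) n (G : nat -> 'M[C]_n) :
  (forall j, (j < n)%N -> (j < \rank (G j))%N) ->
  (b -> forall j, (j < n)%N -> G j \is a realmx) ->
  exists a : 'M[C]_n, [/\ a \is unitarymx, b -> a \is a realmx
    & forall j : 'I_n, (row j a <= G j)%MS].
Proof.
move=> Gr Gb.
suff: forall d, (d <= n)%N -> exists a : 'M[C]_(d, n), [/\ a \is unitarymx,
    b -> a \is a realmx & forall j : 'I_d, (row j a <= G j)%MS].
  by move=> /(_ n (leqnn n)).
elim=> [|d IHd] ltdn.
  by exists 0; split=> [||[]//]; [apply/unitarymxP/matrixP => -[]|
    move=> _; apply/mxOverP => -[]].
have [a [aU ab aG]] := IHd (ltnW ltdn).
(* [K] spans the vectors of [G d] orthogonal to the [d] rows already built; it is nonzero because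
   the rank of [G d] exceeds [d], the number of linear conditions. *)
pose K := kermx (G d *m a^t*) *m G d.
have Ka : K *m a^t* = 0 by rewrite -mulmxA mulmx_ker.
have Kn0 : K != 0.
  apply: contraTneq (Gr d ltdn) => /(@sub_kermxP _ _ _ _ _ _) sK.
  have := mxrankS sK; rewrite !mxrank_ker.
  have := rank_leq_col (G d *m a^t*); have := rank_leq_row (G d); lia.
have Kb : b -> K \is a realmx.
  move=> bT; apply: realmxM; last exact: Gb.
  apply/realmx_ker/realmxM; first exact: Gb.
  by rewrite realmx_trC; [apply: realmx_tr|]; apply: ab.
have [i Ki] : exists i, row i K != 0.
  apply/existsP; apply: contraNT Kn0 => /existsPn K0.
  by apply/eqP/row_matrixP => i; rewrite row0; apply/eqP; rewrite -[_ == _]negbK K0.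
set w := row i K in Ki.
pose q := (w *m w^t*) 0 0.
have q0 : 0 < q.
  by have := dotmx_is_dotmx Ki; rewrite dotmxE.
(* A real scalar normalizes [w], so the new row stays real when [w] is. *)
pose c := (sqrtC q)^-1.
have c0 : 0 < c by rewrite invr_gt0 sqrtC_gt0.
have cr : c^* = c by apply/CrealP/gtr0_real.
have ccq : c * c * q = 1.
  by rewrite -expr2 exprVn sqrtCK mulVf // gt_eqF.
have wG : (w <= G d)%MS by rewrite (submx_trans (row_sub _ _)) ?submxMl.
have wa : w *m a^t* = 0 by rewrite -row_mul Ka row0.
have aw : a *m w^t* = 0.
  by rewrite -[LHS]trmxCK trmxC_mul trmxCK wa trmx0 map_mx0.
rewrite -addn1; exists (col_mx a (c *: w)); split.
- apply/unitarymxP; rewrite tr_col_mx map_row_mx mul_col_row.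
  rewrite (unitarymxP aU) trmxC_scale -!scalemxAl -!scalemxAr wa aw !scaler0.
  rewrite scalerA cr [X in _ *: X](_ : _ = q%:M) ?scale_scalar_mx ?ccq -?scalar_mx_block //.
  by rewrite [LHS]mx11_scalar.
- move=> bT; apply/realmxP; rewrite map_col_mx; congr col_mx.
    exact/realmxP/ab.
  by apply/realmxP/realmxZ; [apply: gtr0_real|apply/realmx_row/Kb].
- move=> j; case: (split_ordP j) => k ->; rewrite ?rowKu ?rowKd ?aG //.
  by rewrite ord1 /= addn0 (submx_trans (row_sub _ _)) // scalemx_sub.
Qed.

End RealMatrices.

(** * Blockwise rotations that make vectors real *)

Definition blockwise (C : numClosedFieldType) n (c : 'I_n -> nat) (A : 'M[C]_n) :=
  forall i j, c i != c j -> A i j = 0.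

Section RealGram.
Variable C : numClosedFieldType.

Lemma blockwiseM n c (A B : 'M[C]_n) :
  blockwise c A -> blockwise c B -> blockwise c (A *m B).
Proof.
move=> Ac Bc i j cij; rewrite mxE big1 // => k _.
have [cik|/Ac ->] := eqVneq (c i) (c k); last by rewrite mul0r.
by rewrite [B k j]Bc ?mulr0 // -cik.
Qed.

Lemma blockwise1 n c : blockwise c (1%:M : 'M[C]_n).
Proof. by move=> i j; rewrite mxE; have [->|//] := eqVneq i j; rewrite eqxx. Qed.

Lemma blockwise_trC n c (A : 'M[C]_n) : blockwise c A -> blockwise c (A^t*).
Proof. by move=> Ac i j cij; rewrite !mxE Ac ?conjC0 // eq_sym. Qed.

Lemma unit_phase (z : C) : exists f, f * f^* = 1 /\ f * z = `|z|.
Proof.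
have [->|z0] := eqVneq z 0.
  by exists 1; rewrite rmorph1 mulr1 mulr0 normr0.
have nz0 : `|z| != 0 by rewrite normr_eq0.
exists (z^* / `|z|); split; last by rewrite mulrAC -[_ * z]mulrC -normCK expr2 mulfK.
rewrite rmorphM /= fmorphV /= conjCK (conj_Creal (normr_real z)) mulrACA -invfM.
by rewrite -[_ * z]mulrC -normCK expr2 mulfV // mulf_neq0.
Qed.

(* Rotating the phase of the line spanned by [b] makes [a + i b] real and fixes
   every vector orthogonal to [b]. *)
Lemma phase_rotation n (c : 'I_n -> nat) t (r : 'rV[C]_n) :
  (forall j, c j != t -> r 0 j = 0) ->
  exists T : 'M[C]_n, [/\ T \is unitarymx, blockwise c T, r *m T \is a realmx
    & forall x : 'rV_n, x \is a realmx -> x *m r^t* \is a realmx -> x *m T = x].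
Proof.
move=> rt.
have [a [b [ar br rab bt]]] : exists a b : 'rV[C]_n, [/\ a \is a realmx,
    b \is a realmx, r = a + 'i *: b & forall j, c j != t -> b 0 j = 0].
  exists (map_mx (fun z => 'Re z) r), (map_mx (fun z => 'Im z) r); split.
  - by apply/mxOverP => i j; rewrite mxE Creal_Re.
  - by apply/mxOverP => i j; rewrite mxE Creal_Im.
  - by apply/rowP => j; rewrite !mxE -Crect.
  - by move=> j /rt; rewrite mxE => ->; rewrite raddf0.
have [b0|bn0] := eqVneq b 0.
  exists 1%:M; rewrite unitarymx1 mulmx1 rab b0 scaler0 addr0 ar; split=> //.
    exact: blockwise1.
  by move=> x _ _; rewrite mulmx1.
pose q := (b *m b^T) 0 0.
have bbq : b *m b^T = q%:M by rewrite [LHS]mx11_scalar.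
have q0 : 0 < q by have := dotmx_is_dotmx bn0; rewrite dotmxE realmx_trC.
have qn0 : q != 0 by rewrite gt_eqF.
have qr : q^* = q by apply/CrealP/gtr0_real.
pose d := (a *m b^T) 0 0 / q.
have abd : a *m b^T = (d * q)%:M by rewrite [LHS]mx11_scalar divfK.
have dr : d \is Num.real.
  apply: rpred_div; last exact: gtr0_real.
  exact: mxOverP (realmxM ar (realmx_tr br)) _ _.
(* [r] is [a - d b], orthogonal to [b], plus [z b]; the phase [f] takes [z] to its modulus. *)
pose z := d + 'i.
have [f [ff fz]] := unit_phase z.
(* With this [k] the matrix [1 + k b^T b] multiplies [b] by [f]. Since [b^T b] squares to [q] times
   itself, its unitarity is the identity [kk]. *)
pose k := (f - 1) / q.
have kk : k + k^* + k * k^* * q = 0.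
  rewrite /k rmorphM rmorphB /= fmorphV /= qr rmorph1.
  rewrite (_ : _ + _ = (f * f^* - 1) / q); first by rewrite ff subrr mul0r.
  by field.
exists (1%:M + k *: (b^T *m b)); split.
- apply/unitarymxP; rewrite linearD /= map_mxD trmx1 map_mx1 trmxC_scale trmxC_mul.
  rewrite (realmx_trC br) (realmx_trC (realmx_tr br)) trmxK.
  rewrite mulmxDl !mulmxDr !mul1mx mulmx1 -!scalemxAl -!scalemxAr.
  rewrite mulmxA -[_ *m b^T]mulmxA bbq mul_mx_scalar -scalemxAl !scalerA.
  set B := b^T *m b.
  by rewrite -addrA -!scalerDl addrA [_ + k]addrC [k * (_ * _)]mulrA kk scale0r addr0.
- move=> i j cij; rewrite !mxE big_ord1 !mxE.
  have [ij|_] := eqVneq i j; first by rewrite ij eqxx in cij.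
  have [ci|/bt->] := eqVneq (c i) t; last by rewrite mul0r mulr0 addr0.
  by rewrite (bt j) ?mulr0 ?addr0 // -ci eq_sym.
- rewrite mulmxDr mulmx1 -scalemxAr mulmxA [in X in X *m b]rab mulmxDl -scalemxAl abd bbq.
  rewrite scale_scalar_mx -raddfD /= mul_scalar_mx scalerA -mulrDl.
  rewrite (_ : k * _ = (f - 1) * z); last by rewrite /k /z; field.
  rewrite (_ : _ + _ = a + (`|z| - d) *: b).
    by apply: realmxD => //; apply: realmxZ => //; rewrite rpredB // normr_real.
  by rewrite rab -addrA -scalerDl -fz; congr (_ + _ *: _); rewrite /z; ring.
- move=> x xr; rewrite mulmxDr mulmx1 -scalemxAr mulmxA rab linearD /= map_mxD.
  rewrite trmxC_scale !realmx_trC // mulmxDr -scalemxAr => xb.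
  (* [x r^t*] is [x a^T - i x b^T] with both products real, so its reality forces [x b^T = 0]. *)
  suff -> : x *m b^T = 0 by rewrite mul0mx scaler0 addr0.
  have := xb; have /mxOverP xar := realmxM xr (realmx_tr ar).
  have /mxOverP xbr := realmxM xr (realmx_tr br) => /mxOverP xx.
  apply/matrixP => i j; rewrite [RHS]mxE; have := elimT (Creal_ImP _) (xx i j).
  rewrite [in 'Im _]mxE; set u := (x *m a^T) i j; rewrite mxE {}/u.
  rewrite conjCi mulNr raddfB /= (elimT (Creal_ImP _) (xar i j)) add0r ImMil.
  by rewrite (elimT (Creal_ReP _) (xbr i j)) => /eqP; rewrite oppr_eq0 => /eqP.
Qed.

(** Induction on the number of vectors: once the first [p] are real, their inner products with the
    next one are real, so the phase rotation that makes the next one real fixes them. *)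
Lemma real_gram_rotation n (c : 'I_n -> nat) p (X : nat -> 'rV[C]_n) :
  (forall i, (i < p)%N -> exists t, forall j, c j != t -> X i 0 j = 0) ->
  (forall i j, (i < p)%N -> (j < p)%N -> X i *m (X j)^t* \is a realmx) ->
  exists y : 'M[C]_n, [/\ y \is unitarymx, blockwise c y
    & forall i, (i < p)%N -> X i *m y \is a realmx].
Proof.
elim: p => [|p IHp] Xc Xr.
  by exists 1%:M; split=> //; [apply: unitarymx1|apply: blockwise1].
have [i /ltnW/Xc //|i j /ltnW ip /ltnW|y [yU yc yr]] := IHp; first exact: Xr.
have [t Xt] := Xc p (ltnSn p).
have [|T [TU Tc Tr Tx]] := @phase_rotation n c t (X p *m y).
  move=> j cj; rewrite mxE big1 // => k _.
  have [ck|/Xt ->] := eqVneq (c k) t; last by rewrite mul0r.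
  by rewrite yc ?mulr0 // ck eq_sym.
exists (y *m T); split; [exact: mul_unitarymx|exact: blockwiseM|].
move=> i; rewrite ltnS leq_eqVlt mulmxA => /predU1P[->//|ip].
rewrite Tx ?yr //.
by rewrite trmxC_mul mulmxA -(mulmxA (X i)) (unitarymxP yU) mulmx1 Xr // ltnW.
Qed.

End RealGram.

(** * Making the compressions of the block projections real at once *)

Section Sufficiency.
Variable C : numClosedFieldType.

Lemma unitary_diagonalize m (P : 'M[C]_m) : P^t* = P ->
  exists2 u : 'M_m, u \is unitarymx &
    exists2 d : 'rV_m, d \is a realmx & u *m P *m u^t* = diag_mx d.
Proof.
move=> Ph; exists (spectralmx P); first exact: spectral_unitarymx.
have uU := spectral_unitarymx P; set u := spectralmx P in uU *.
have /orthomx_spectralP PE : P \is normalmx by apply/normalmxP; rewrite Ph.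
have dE : u *m P *m u^t* = diag_mx (spectral_diag P).
  rewrite {1}PE invmx_unitary // !mulmxA (unitarymxP uU) mul1mx -mulmxA.
  by rewrite (unitarymxP uU) mulmx1.
exists (spectral_diag P) => //; apply/mxOverP => i j; rewrite ord1; apply/CrealP.
have /(congr1 (fun A : 'M_m => A j j)) : (u *m P *m u^t*)^t* = u *m P *m u^t*.
  by rewrite !trmxC_mul trmxCK Ph mulmxA.
by rewrite dE !mxE eqxx !mulr1n.
Qed.

Lemma conj_diagmxE m (f : 'rV[C]_m) (Q : 'M_m) i j :
  (diag_mx f *m Q *m (diag_mx f)^t*) i j = f 0 i * Q i j * (f 0 j)^*.
Proof. by rewrite tr_diag_mx map_diag_mx mul_diag_mx mul_mx_diag !mxE. Qed.

(** After diagonalizing [P], a diagonal phase matrix leaves it diagonal and makes [Q] real as soon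
    as the off-diagonal entries of [Q] are [w_i] times the conjugate of [w_j]. Dimension two leaves
    a single conjugate pair of such entries; rank one gives the form outright. *)
Lemma hermitian_pair_real m (P Q : 'M[C]_m) : P^t* = P -> Q^t* = Q ->
  (m <= 2)%N \/ (exists v : 'cV_m, Q = v *m v^t*) ->
  exists2 u : 'M_m, u \is unitarymx &
    (u *m P *m u^t* \is a realmx) && (u *m Q *m u^t* \is a realmx).
Proof.
move=> Ph Qh Qc; have [u uU [d dr dE]] := unitary_diagonalize Ph.
set Q' := u *m Q *m u^t*.
have Q'h : Q'^t* = Q' by rewrite !trmxC_mul trmxCK Qh mulmxA.
have hE i j : Q' i j = (Q' j i)^* by rewrite -{1}Q'h !mxE.
have [w wQ] : exists w : 'I_m -> C, forall i j, i != j -> Q' i j = w i * (w j)^*.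
  case: Qc => [|[v QE]].
    case: m {P Ph Q Qh u uU d dr dE} Q' Q'h hE => [|[|[|//]]] Q' Q'h hE _.
    - by exists (fun=> 0) => -[].
    - by exists (fun=> 0) => i j; rewrite !ord1.
    - exists (fun i => if i == 0 then 1 else Q' i 0) => i j.
      have [->|i0] := eqVneq i 0; have [->|j0] := eqVneq j 0 => // ij.
      + by rewrite mul1r hE.
      + by rewrite rmorph1 mulr1.
      + by case: i j i0 j0 ij => [[|[|]]] // ? [[|[|]]].
  exists (fun i => (u *m v) i 0) => i j _.
  rewrite /Q' QE (_ : _ *m _ = (u *m v) *m (u *m v)^t*); last by rewrite trmxC_mul !mulmxA.
  by rewrite mxE big_ord1 !mxE.
have /fin_all_exists[f fP] := fun i => unit_phase (w i).
pose D := diag_mx (\row_i f i).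
have DU : D \is unitarymx.
  apply/unitarymxP/matrixP => i j; rewrite -[X in X *m _]mulmx1 conj_diagmxE !mxE.
  by case: eqVneq => [->|]; rewrite ?mulr1 ?(fP j).1 // mulr0 mul0r.
exists (D *m u); first exact: mul_unitarymx.
have cE A : D *m u *m A *m (D *m u)^t* = D *m (u *m A *m u^t*) *m D^t*.
  by rewrite trmxC_mul !mulmxA.
rewrite !cE dE -/Q'; clearbody Q'; apply/andP; split; apply/mxOverP => i j; rewrite conj_diagmxE !mxE.
  case: eqVneq => [->|]; last by rewrite mulr0 mul0r.
  by rewrite mulrAC (fP j).1 mul1r mulr1n (mxOverP dr).
have [<-|ij] := eqVneq i j.
  by rewrite mulrAC (fP i).1 mul1r; apply/CrealP; rewrite -hE.
rewrite wQ // mulrA (fP i).2 -mulrA -rmorphM /= mulrC; apply: rpredM.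
  by rewrite mulrC (fP j).2; apply/CrealP; rewrite conjCK conj_Creal // normr_real.
by rewrite normr_real.
Qed.

(** For [c] the block index these are the block projections [D_a]; general colourings allow
    restriction to selected coordinates. *)
Definition color_proj n (c : 'I_n -> nat) a : 'M[C]_n :=
  diag_mx (\row_i (c i == a)%:R).

Lemma color_proj_mul n (c : 'I_n -> nat) a b :
  color_proj c a *m color_proj c b = if a == b then color_proj c a else 0.
Proof.
apply/matrixP => i j; have [<-|ab] := eqVneq a b; rewrite mul_diag_mx !mxE.
  by rewrite mulrnAr -natrM; congr (_%:R *+ _); case: (c i == a).
by have [->|] := eqVneq (c i) a; rewrite ?(negPf ab) ?mul0rn ?mulr0 ?mul0r.
Qed.

Lemma color_proj_trC n (c : 'I_n -> nat) a : (color_proj c a)^t* = color_proj c a.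
Proof.
by rewrite /color_proj tr_diag_mx map_diag_mx; congr diag_mx; apply/rowP => i; rewrite !mxE rmorph_nat.
Qed.

Lemma sum_color_proj n (c : 'I_n -> nat) k :
  (forall i, (c i < k)%N) -> \sum_(a < k) color_proj c a = 1%:M.
Proof.
move=> ck; rewrite -raddf_sum; apply/matrixP => i j; rewrite !mxE; congr (_ *+ _).
rewrite summxE (bigD1 (Ordinal (ck i))) //= !mxE eqxx big1 ?addr0 // => a ai.
by rewrite !mxE eq_sym; case: eqP => // E; case/eqP: ai; apply: val_inj.
Qed.

Lemma mulmx_trC_row m n (A B : 'M[C]_(m, n)) i j :
  row i A *m (row j B)^t* = ((A *m B^t*) i j)%:M.
Proof.
by rewrite [LHS]mx11_scalar; congr _%:M; rewrite !mxE; apply: eq_bigr => k _; rewrite !mxE.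
Qed.

(** The compressions sum to the identity, so with at most three colours it is enough to make two of
    them real. A singleton colour has a compression of the form [v v^t*], and in dimension one every
    Hermitian matrix is real. *)
Lemma few_blocks_real n (c : 'I_n -> nat) k m (V : 'M[C]_(m, n)) :
  V \is unitarymx -> (forall i, (c i < k)%N) ->
  [\/ (m <= 1)%N, (k <= 2)%N
    | (k <= 3)%N /\ ((m <= 2)%N \/ exists i0, forall j, c j = c i0 -> j = i0)] ->
  exists2 u : 'M_m, u \is unitarymx &
    forall a, u *m (V *m color_proj c a *m V^t*) *m u^t* \is a realmx.
Proof.
move=> VU ck; set A := fun a => V *m color_proj c a *m V^t*.
have Ah a : (A a)^t* = A a by rewrite !trmxC_mul trmxCK color_proj_trC mulmxA.
have colA a : (forall i, c i != a) -> A a = 0.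
  move=> ca; rewrite /A (_ : color_proj c a = 0) ?mulmx0 ?mul0mx //.
  by apply/matrixP => i j; rewrite !mxE (negPf (ca i)) mul0rn.
have two a b : (k <= 3)%N -> (a < 3)%N -> (b < 3)%N -> a != b ->
    (m <= 2)%N \/ (exists v : 'cV_m, A b = v *m v^t*) ->
    exists2 u : 'M_m, u \is unitarymx & forall a, u *m A a *m u^t* \is a realmx.
  move=> k3 a3 b3 ab Ac; have [u uU /andP[ua ub]] := hermitian_pair_real (Ah a) (Ah b) Ac.
  exists u; first exact: uU.
  move=> d.
  have [->//|da] := eqVneq d a; have [->//|db] := eqVneq d b.
  have [d3|d3] := ltnP d 3; last first.
    rewrite colA ?mulmx0 ?mul0mx; first by apply/realmxP; rewrite map_mx0.
    by move=> i; have := ck i; lia.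
  suff -> : A d = 1%:M - A a - A b.
    rewrite !mulmxBr !mulmxBl mulmx1 (unitarymxP uU).
    by apply/realmxP; rewrite !map_mxB !(realmxC ua) !(realmxC ub) map_mx1.
  rewrite -[1%:M](unitarymxP VU) -{1}(mulmx1 V) /A -!mulmxBl -!mulmxBr; congr (_ *m _ *m _).
  apply/matrixP => i j; rewrite !mxE -!mulrnBl; congr (_ *+ _).
  have E : ((c i == a) + (c i == b) + (c i == d) = 1)%N.
    by have := ck i; case: eqP; case: eqP; case: eqP; lia.
  rewrite [X in X - _ - _](_ : _ = ((c i == a) + (c i == b) + (c i == d))%:R); last by rewrite E.
  by rewrite !natrD; ring.
case=> [m1|k2|[k3 [m2|[i0 ci0]]]].
- exists 1%:M; first exact: unitarymx1.
  move=> a; rewrite -/(A a) trmx1 map_mx1 mulmx1 mul1mx; apply/realmxP/matrixP => i j.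
  have -> : j = i by apply: val_inj => /=; have := ltn_ord i; have := ltn_ord j; lia.
  by rewrite -[in RHS]Ah !mxE.
(* Colour 2 does not occur, so its compression is 0, of the form [v v^t*] with [v = 0]. *)
- apply: (two 0%N 2%N) => //; first by lia.
  right; exists 0; rewrite mul0mx colA // => i; have := ck i; lia.
- by apply: (two 0%N 1%N) => //; left.
(* The truth value of [c i0 == 0], read as a number, is a colour below 3 other than [c i0]. *)
- apply: (two (c i0 == 0%N) (c i0)) => //; [by case: eqP|by have := ck i0; lia|by case: eqP; lia|].
  right; exists (col i0 V); apply/matrixP => i j.
  rewrite /A mul_mx_diag !mxE big_ord1 !mxE (bigD1 i0) //= !mxE eqxx mulr1 big1 ?addr0 //.
  by move=> l li0; rewrite !mxE; case: eqP => [/ci0 E|]; [rewrite E eqxx in li0|rewrite mulr0 mul0r].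
Qed.

(** Apply [real_gram_rotation] to the rows of all [u V D_a]: rows of different colours are
    orthogonal, and Gram entries within a colour are entries of a real compression. Summing over the
    colours gives [u V y], which spans the same space as [V y]. *)
Lemma blockwise_real_span n (c : 'I_n -> nat) k m (V : 'M[C]_(m, n)) :
  V \is unitarymx -> (forall i, (c i < k)%N) ->
  [\/ (m <= 1)%N, (k <= 2)%N
    | (k <= 3)%N /\ ((m <= 2)%N \/ exists i0, forall j, c j = c i0 -> j = i0)] ->
  exists y : 'M[C]_n, [/\ y \is unitarymx, blockwise c y
    & exists2 W : 'M_(m, n), W \is a realmx & (W :=: V *m y)%MS].
Proof.
move=> VU ck H; have [u uU ur] := few_blocks_real VU ck H.
pose T := ('I_m * 'I_k)%type.
pose X (t : T) := row t.1 (u *m V *m color_proj c t.2).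
(* The pairs of a row and a colour are numbered by naturals; the default 0 is never met below
   [#|{: T}|]. *)
pose X' i := if insub i is Some o then X (enum_val (o : 'I_#|{: T}|)) else 0.
have X'E (o : 'I_#|{: T}|) : X' o = X (enum_val o) by rewrite /X' valK.
have [i ip|i j ip jp|y [yU yc yr]] := @real_gram_rotation C n c #|{: T}| X'.
- exists (val (enum_val (Ordinal ip)).2) => j cj; rewrite (X'E (Ordinal ip)).
  by rewrite /X mul_mx_diag !mxE (negPf cj) mulr0.
- rewrite (X'E (Ordinal ip)) (X'E (Ordinal jp)).
  case: (enum_val _) => i1 a; case: (enum_val _) => i2 b.
  rewrite mulmx_trC_row /= trmxC_mul color_proj_trC mulmxA.
  rewrite -[_ *m color_proj c b]mulmxA color_proj_mul; case: eqP => _; last first.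
    by rewrite mulmx0 mul0mx mxE raddf0; apply/realmxP; rewrite map_mx0.
  have /mxOverP/(_ i1 i2) := ur a; rewrite trmxC_mul !mulmxA => xr.
  by apply/mxOverP => ? ?; rewrite !ord1 mxE mulr1n.
exists y; split; [exact: yU|exact: yc|].
exists (u *m V *m y).
  have -> : u *m V *m y = \sum_(a < k) (u *m V *m color_proj c a *m y).
    by rewrite -mulmx_suml -mulmx_sumr sum_color_proj // mulmx1.
  apply/mxOverP => i j; rewrite summxE; apply: rpred_sum => a _.
  have := yr (enum_rank ((i, a) : T)) (ltn_ord _); rewrite X'E enum_rankK /X -row_mul.
  by move=> /mxOverP/(_ 0 j); rewrite mxE.
by rewrite -mulmxA; apply: eqmxMfull; rewrite row_full_unit unitarymx_unit.
Qed.

End Sufficiency.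

(** * Partial sums and block indices *)

Lemma leq_sumn_take (s : seq nat) a b : (a <= b)%N -> (sumn (take a s) <= sumn (take b s))%N.
Proof.
by move=> ab; rewrite -(subnKC ab) takeD sumn_cat leq_addr.
Qed.

(** The partial sums are nondecreasing, so only the one at position [a], which includes part [a],
    has to be compared with [i]. *)
Lemma blk_leq s i a : (a < size s)%N -> (blk s i <= a)%N = (i < sumn (take a.+1 s))%N.
Proof.
move=> sa; have nE b : (b < size s)%N -> nth 0%N (psums s) b = sumn (take b.+1 s).
  by move=> sb; rewrite (nth_map 0%N) ?size_iota // nth_iota.
apply/idP/idP => [le|lt].
  have hs : has (fun t => i < t)%N (psums s).
    by rewrite has_find size_map size_iota; apply: leq_ltn_trans sa.
  have := nth_find 0%N hs; rewrite nE ?(leq_ltn_trans le sa) //.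
  by move=> /leq_trans; apply; apply: leq_sumn_take.
by rewrite leqNgt; apply/negP => /(before_find 0%N); rewrite nE // lt.
Qed.

Lemma blk_size s i : (i < sumn s)%N -> (blk s i < size s)%N.
Proof.
case: s => // x s lt; have := @blk_leq (x :: s) i (size s) (ltnSn _).
by rewrite take_oversize // lt => E; rewrite -[size _]/((size s).+1) ltnS E.
Qed.

Lemma blk_offset s a t : (a < size s)%N -> (t < nth 0 s a)%N ->
  blk s (sumn (take a s) + t) = a /\ (sumn (take a s) + t < sumn s)%N.
Proof.
move=> sa lt.
have lt1 : (sumn (take a s) + t < sumn (take a.+1 s))%N.
  by rewrite (take_nth 0%N) // sumn_rcons ltn_add2l.
split; last by rewrite (leq_trans lt1) // -{2}(take_size s) leq_sumn_take.
apply/eqP; rewrite eqn_leq blk_leq // lt1 /=; case: a sa {lt lt1} => // a sa.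
by rewrite ltnNge blk_leq ?(ltnW sa) // -leqNgt leq_addr.
Qed.

(** * Unitary bases of flags and the stabilizer of the standard flag *)

Section StandardFlag.
Variable C : numClosedFieldType.

Lemma mul_pid_mxE n d (A : 'M[C]_n) i j :
  (pid_mx d *m A) i j = if (i < d)%N then A i j else 0.
Proof.
rewrite mxE (bigD1 i) //= mxE eqxx /= big1 ?addr0; last first.
  by move=> k; rewrite eq_sym -(inj_eq val_inj) /= => /negPf ki; rewrite mxE ki mul0r.
by case: ifP => _; rewrite ?mul1r ?mul0r.
Qed.

Lemma mul_mx_pidE n d (A : 'M[C]_n) i j :
  (A *m pid_mx d) i j = if (j < d)%N then A i j else 0.
Proof. by rewrite -[_ *m _]trmxK mxE trmx_mul tr_pid_mx mul_pid_mxE mxE. Qed.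

(** Row [j] of the basis is taken in the member of the flag indexed by the block of [j]. The rows up
    to block [i] then lie in [F i], and ranks turn the inclusion into equality. The boolean [b]
    switches on the real version. *)
Lemma flag_basis (b : bool) n s (F : 'I_(size s) -> 'M[C]_n) : sumn s = n ->
  (forall i, \rank (F i) = sumn (take i.+1 s)) ->
  (forall i j : 'I_(size s), (i <= j)%N -> (F i <= F j)%MS) ->
  (b -> forall i, F i \is a realmx) ->
  exists a : 'M[C]_n, [/\ a \is unitarymx, b -> a \is a realmx
    & forall i : 'I_(size s), ((pid_mx (sumn (take i.+1 s)) : 'M_n) *m a :=: F i)%MS].
Proof.
move=> sn Fr Fle Fb.
pose G (j : nat) := if insub (blk s j) is Some i then F i else 0.
have GE (j : 'I_n) : exists2 i : 'I_(size s), i = blk s j :> nat & G j = F i.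
  have js : (blk s j < size s)%N by rewrite blk_size // sn.
  by exists (Ordinal js) => //; rewrite /G insubT.
have [j jn|bT j jn|a [aU ab aG]] := @adapted_basis C b n G.
- have [i /= iE ->] := GE (Ordinal jn).
  by rewrite Fr -blk_leq // iE.
- by have [i _ /= ->] := GE (Ordinal jn); apply: Fb.
exists a; split; [exact: aU|exact: ab|].
move=> i; apply/eqmxP.
have le : ((pid_mx (sumn (take i.+1 s)) : 'M_n) *m a <= F i)%MS.
  apply/row_subP => k; have [lt|ge] := boolP (k < sumn (take i.+1 s))%N; last first.
    rewrite (_ : row k _ = 0) ?sub0mx //.
    by apply/rowP => j; rewrite mxE mul_pid_mxE (negPf ge) mxE.
  rewrite (_ : row k _ = row k a); last by apply/rowP => j; rewrite mxE mul_pid_mxE lt mxE.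
  have [l lE GF] := GE k; rewrite (submx_trans (aG k)) // GF Fle // lE blk_leq //.
rewrite le /= -(geq_leqif (mxrank_leqif_sup le)) Fr mxrankMfree.
  have dn : (sumn (take i.+1 s) <= n)%N.
    by rewrite -sn -[X in (_ <= sumn X)%N](take_size s) leq_sumn_take.
  by rewrite rank_pid_mx.
by rewrite row_free_unit unitarymx_unit.
Qed.

Lemma pid_mx_blockwise n s (h : 'M[C]_n) (a : 'I_(size s)) : blockwise (blk s) h ->
  ((pid_mx (sumn (take a.+1 s)) : 'M_n) *m h <= (pid_mx (sumn (take a.+1 s)) : 'M_n))%MS.
Proof.
move=> hc; set d := sumn _.
rewrite (_ : _ *m h = pid_mx d *m h *m pid_mx d) ?submxMl //.
apply/matrixP => i j; rewrite mul_mx_pidE mul_pid_mxE.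
case: ifP => id; case: ifP => jd //.
rewrite hc //; apply/eqP => ij; have := @blk_leq s i a (ltn_ord a).
by rewrite ij blk_leq // -/d id jd.
Qed.

(** Preserving the standard flag kills the entries on one side of the block diagonal. The inclusions
    are equalities by rank, so the inverse [h^t*] preserves the flag too, which kills the other
    side. *)
Lemma blockwise_stabilizer n s (h : 'M[C]_n) : sumn s = n -> h \is unitarymx ->
  (forall a : 'I_(size s),
    ((pid_mx (sumn (take a.+1 s)) : 'M_n) *m h <= (pid_mx (sumn (take a.+1 s)) : 'M_n))%MS) ->
  blockwise (blk s) h.
Proof.
move=> sn hU hs.
have low (g : 'M[C]_n) : (forall a : 'I_(size s),
    ((pid_mx (sumn (take a.+1 s)) : 'M_n) *m g <= (pid_mx (sumn (take a.+1 s)) : 'M_n))%MS) ->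
    forall i j : 'I_n, (blk s i < blk s j)%N -> g i j = 0.
  move=> gs i j lt; have is_ : (blk s i < size s)%N by rewrite blk_size // sn.
  have /submxP[D] := gs (Ordinal is_); set d := sumn _ => E.
  have id : (i < d)%N by rewrite -blk_leq.
  have jd : (j < d)%N = false by rewrite -blk_leq // leqNgt lt.
  have /(congr1 (fun A : 'M_n => A i j)) := E; rewrite mul_pid_mxE id => ->.
  by rewrite mul_mx_pidE jd.
have hs' (a : 'I_(size s)) :
    ((pid_mx (sumn (take a.+1 s)) : 'M_n) *m h^t* <= (pid_mx (sumn (take a.+1 s)) : 'M_n))%MS.
  set d := sumn _.
  have le := hs a; rewrite -/d in le.
  have : ((pid_mx d : 'M_n) <= (pid_mx d : 'M_n) *m h)%MS.
    rewrite -(geq_leqif (mxrank_leqif_sup le)) mxrankMfree //.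
    by rewrite row_free_unit unitarymx_unit.
  by move=> /(submxMr (h^t*)); rewrite -mulmxA (unitarymxP hU) mulmx1.
move=> i j; rewrite neq_ltn => /orP[/(low h hs)//|/(low _ hs')].
by rewrite !mxE => /eqP; rewrite conjC_eq0 => /eqP.
Qed.

End StandardFlag.

(** * Moving one subspace to a real subspace *)

Section RealTranslate.
Variable C : numClosedFieldType.

Lemma orthonormal_rows m n (A : 'M[C]_(m, n)) :
  exists2 V : 'M[C]_(\rank A, n), V \is unitarymx & (V :=: A)%MS.
Proof.
exists (schmidt (row_base A)); first by apply: schmidt_unitarymx; apply: rank_leq_col.
apply: eqmx_trans (eq_row_base A); apply: eqmx_schmidt_free.
by rewrite /row_free eq_row_base.
Qed.

(** If [m] is the dimension, an orthonormal basis of [F] is treated directly. If it is the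
    codimension, the orthogonal complement is moved to a real subspace, whose own complement is
    again real. *)
Lemma real_translate n (c : 'I_n -> nat) k m (F : 'M[C]_n) :
  m = \rank F \/ m = (n - \rank F)%N -> (forall i, (c i < k)%N) ->
  [\/ (m <= 1)%N, (k <= 2)%N
    | (k <= 3)%N /\ ((m <= 2)%N \/ exists i0, forall j, c j = c i0 -> j = i0)] ->
  exists y : 'M[C]_n, [/\ y \is unitarymx, blockwise c y
    & exists2 W : 'M_n, W \is a realmx & (W == F *m y)%MS].
Proof.
move=> mF ck H; case: mF => mE; rewrite {m}mE in H.
  have [V VU VF] := orthonormal_rows F.
  have [y [yU yc [W Wr WE]]] := blockwise_real_span VU ck H.
  exists y; split; [exact: yU|exact: yc|].
  exists ((pid_mx (\rank F) : 'M_(n, \rank F)) *m W).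
    exact: realmxM (realmx_pid _ _ _ _) Wr.
  apply/eqmxP; apply: eqmx_trans (eqmxMr y VF); apply: eqmx_trans WE.
  by apply: eqmxMfull; rewrite /row_full rank_pid_mx // rank_leq_col.
have rK : \rank (kermx (F^t*)) = (n - \rank F)%N.
  by rewrite mxrank_ker mxrank_map mxrank_tr.
rewrite -rK in H.
have [V VU VK] := orthonormal_rows (kermx (F^t*)).
have [y [yU yc [W Wr WE]]] := blockwise_real_span VU ck H.
have VF : V *m F^t* = 0 by apply/sub_kermxP; rewrite VK.
have FV : F *m V^t* = 0.
  by rewrite -[LHS]trmxCK trmxC_mul trmxCK VF trmx0 map_mx0.
have rW : \rank W = (n - \rank F)%N.
  by rewrite WE mxrankMfree ?VK // row_free_unit unitarymx_unit.
have rkW : \rank (kermx W^T) = (n - (n - \rank F))%N.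
  by rewrite mxrank_ker mxrank_tr; congr (n - _)%N; exact: rW.
exists y; split; [exact: yU|exact: yc|].
(* [y] is unitary, so [F y] is orthogonal to the real [W], and equal ranks identify it with
   [kermx W^T]. *)
exists (kermx W^T); first exact: realmx_ker (realmx_tr Wr).
have le : (F *m y <= kermx W^T)%MS.
  apply/sub_kermxP; rewrite -(realmx_trC Wr).
  have /submxP[D ->] : (W <= V *m y)%MS by rewrite WE.
  rewrite !trmxC_mul mulmxA -[F *m y *m _]mulmxA [y *m _]mulmxA (unitarymxP yU) mul1mx.
  by rewrite FV mul0mx.
rewrite andbC le /= -(geq_leqif (mxrank_leqif_sup le)) rkW.
rewrite mxrankMfree ?row_free_unit ?unitarymx_unit //.
by have := rank_leq_col F; lia.
Qed.

End RealTranslate.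


(** * Condition (i) and the three orbit conditions *)

Section Equivalences.
Variables (R : realType) (n : nat).
Local Notation C := (Cx R).
Local Notation std s i := (pid_mx (sumn (take i.+1 s)) : 'M[C]_n).

Lemma blockUP s (A : 'M[C]_n) :
  blockU s A <-> A \is unitarymx /\ blockwise (fun i => blk s i) A.
Proof.
rewrite /blockU; split=> [/andP[AU /forallP Ab]|[AU Ab]].
  split; first exact: AU.
  by move=> i j; have /forallP/(_ j)/implyP Aij := Ab i; move=> /Aij/eqP.
apply/andP; split; first exact: AU.
by apply/forallP => i; apply/forallP => j; apply/implyP => /Ab ->; apply: eqxx.
Qed.

Lemma blockU_trC s (A : 'M[C]_n) : blockU s A -> blockU s (A^t*).
Proof.
by move=> /blockUP[AU Ac]; apply/blockUP; split;
  [exact: unitarymx_trC|exact: blockwise_trC].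
Qed.

Lemma blockU_tr s (A : 'M[C]_n) : blockU s A -> blockU s A^T.
Proof.
move=> /blockUP[AU Ac]; apply/blockUP; split; first exact: unitarymx_tr.
by move=> i j ij; rewrite mxE Ac // eq_sym.
Qed.

Lemma orthmx_trC (A : 'M[C]_n) : orthmx A -> orthmx (A^t*).
Proof.
move=> /andP[AU Ar]; apply/andP; split; first exact: unitarymx_trC.
by rewrite (realmx_trC Ar); exact: realmx_tr Ar.
Qed.

Lemma std_is_flag s (a : 'M[C]_n) : sumn s = n -> a \is unitarymx ->
  is_flag (fun i : 'I_(size s) => std s i *m a).
Proof.
move=> sn aU; split=> [i|i j ij].
  have le : (sumn (take i.+1 s) <= n)%N.
    by rewrite -sn -[X in (_ <= sumn X)%N](take_size s) leq_sumn_take.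
  rewrite mxrankMfree ?rank_pid_mx //.
  by rewrite row_free_unit; apply: unitarymx_unit.
apply: submxMr; rewrite (_ : std s i = std s i *m std s j) ?submxMl //.
have le : (sumn (take j.+1 s) <= n)%N.
  by rewrite -sn -[X in (_ <= sumn X)%N](take_size s) leq_sumn_take.
have le' := @leq_sumn_take s i.+1 j.+1 ij.
by rewrite mul_pid_mx (minn_idPl le') (minn_idPr (leq_trans le' le)).
Qed.

Lemma std_is_real_flag s (a : 'M[C]_n) : sumn s = n -> orthmx a ->
  is_real_flag (fun i : 'I_(size s) => std s i *m a).
Proof.
move=> sn /andP[aU ar]; split; first exact: std_is_flag.
move=> i; exists (std s i *m a); rewrite !submx_refl !andbT.
exact: realmxM (realmx_pid _ _ _ _) ar.
Qed.

Lemma is_flag_basis s (F : 'I_(size s) -> 'M[C]_n) : sumn s = n -> is_flag F ->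
  exists2 a : 'M[C]_n, a \is unitarymx
    & forall i : 'I_(size s), (std s i *m a :=: F i)%MS.
Proof.
move=> sn [Fr Fle]; have [//|a [aU _ aF]] := flag_basis (b := false) sn Fr Fle.
by exists a; [exact: aU|exact: aF].
Qed.

Lemma is_real_flag_basis s (F : 'I_(size s) -> 'M[C]_n) : sumn s = n -> is_real_flag F ->
  exists2 a : 'M[C]_n, orthmx a
    & forall i : 'I_(size s), (std s i *m a :=: F i)%MS.
Proof.
move=> sn [[Fr Fle] /fin_all_exists[W WF]].
have WE i : (W i :=: F i)%MS by apply/eqmxP; case/andP: (WF i).
have [i|i j ij|_ i|a [aU ar aW]] := @flag_basis C true n s W sn.
- by rewrite WE Fr.
- by rewrite !WE Fle.
- by case/andP: (WF i).
exists a; first by apply/andP; split; [exact: aU|exact: ar].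
by move=> i; apply: eqmx_trans (aW i) (WE i).
Qed.

Lemma is_real_flag_orth s (E : 'I_(size s) -> 'M[C]_n) (o : 'M[C]_n) :
  orthmx o -> is_real_flag E -> is_real_flag (fun i => E i *m o).
Proof.
move=> /andP[oU or] [[Er Ele] EW]; split; first split.
- by move=> i; rewrite mxrankMfree ?Er // row_free_unit; apply: unitarymx_unit.
- by move=> i j ij; apply/submxMr/Ele.
- move=> i; have [W /andP[Wr /eqmxP WE]] := EW i; exists (W *m o).
  by apply/andP; split; [exact: realmxM|apply/eqmxP/eqmxMr].
Qed.

Lemma std_blockU s (h : 'M[C]_n) i : blockU s h -> (i < size s)%N ->
  (std s i *m h :=: std s i)%MS.
Proof.
move=> /blockUP[hU hc] is_; have /= le := pid_mx_blockwise (Ordinal is_) hc.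
apply/eqmxP; rewrite le -(geq_leqif (mxrank_leqif_sup le)) mxrankMfree.
  exact: leqnn.
by rewrite row_free_unit; apply: unitarymx_unit.
Qed.

Lemma stabilizer_blockU s (h : 'M[C]_n) : sumn s = n -> h \is unitarymx ->
  (forall i : 'I_(size s), (std s i *m h :=: std s i)%MS) -> blockU s h.
Proof.
move=> sn hU hs; apply/blockUP; split; first exact: hU.
by apply: blockwise_stabilizer => // i; rewrite hs.
Qed.

(** This and the next two definitions are conditions (i), (ii)' and (ii); (ii)'' is
    [flag_translates] with the lists exchanged. *)
Definition decomposes ns ms := forall g : 'M[C]_n, g \is unitarymx ->
  exists x o h : 'M[C]_n,
    [/\ blockU ns x, orthmx o, blockU ms h & g = x *m o *m h].

Definition flag_translates ns ms :=
  forall F : 'I_(size ms) -> 'M[C]_n, is_flag F ->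
    exists x : 'M[C]_n, exists E : 'I_(size ms) -> 'M[C]_n,
      [/\ blockU ns x, is_real_flag E & flag_eq E (flag_act x F)].

Definition flag_pairs ns ms :=
  forall (F1 : 'I_(size ms) -> 'M[C]_n) (F2 : 'I_(size ns) -> 'M[C]_n),
    is_flag F1 -> is_flag F2 ->
    exists g : 'M[C]_n, exists (E1 : 'I_(size ms) -> 'M[C]_n)
                               (E2 : 'I_(size ns) -> 'M[C]_n),
      [/\ g \is unitarymx, is_real_flag E1, is_real_flag E2,
          flag_eq E1 (flag_act g F1) & flag_eq E2 (flag_act g F2)].

(** Adjoints reverse the order of the three factors. *)
Lemma decomposes_sym ns ms : decomposes ns ms -> decomposes ms ns.
Proof.
move=> D g gU; have [x [o [h [xL oO hH gE]]]] := D _ (unitarymx_trC gU).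
exists (h^t*), (o^t*), (x^t*); split; [exact: blockU_trC|exact: orthmx_trC|exact: blockU_trC|].
by rewrite -[g]trmxCK gE !trmxC_mul mulmxA.
Qed.

Variables ns ms : seq nat.
Hypotheses (nsn : sumn ns = n) (msn : sumn ms = n).

(** Flags with bases [a1] and [a2] have relative position [a2 a1^t*]. If this is [x o h], right
    multiplication by [a2^t* x] takes [a2] to [x] and [a1] to [h^t* o^t*]. The standard flags absorb
    [x] and [h^t*], leaving the real bases [1] and [o^t*]. *)
Lemma decomposes_flag_pairs : decomposes ns ms -> flag_pairs ns ms.
Proof.
move=> D F1 F2 /(is_flag_basis msn)[a1 a1U aF1] /(is_flag_basis nsn)[a2 a2U aF2].
have [x [o [h [xL oO hH gE]]]] := D _ (mul_unitarymx a2U (unitarymx_trC a1U)).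
have xU : x \is unitarymx by case/andP: xL.
have oO' := orthmx_trC oO.
have a2x : a2 *m (a2^t* *m x) = x by rewrite mulmxA (unitarymxP a2U) mul1mx.
have a1x : a1 *m (a2^t* *m x) = h^t* *m o^t*.
  have -> : a1 *m (a2^t* *m x) = (a2 *m a1^t*)^t* *m x.
    by rewrite trmxC_mul trmxCK mulmxA.
  by rewrite gE !trmxC_mul -!mulmxA (unitarymx_trK xU) mulmx1.
exists (a2^t* *m x)^T, (fun i => std ms i *m o^t*), (fun i => std ns i *m 1%:M); split.
- exact: unitarymx_tr (mul_unitarymx (unitarymx_trC a2U) xU).
- exact: std_is_real_flag msn oO'.
- apply: (std_is_real_flag nsn); apply/andP.
  split; [exact: unitarymx1|exact: realmx1].
- move=> i; apply/eqmxP; rewrite /flag_act trmxK.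
  apply: eqmx_trans (eqmxMr _ (aF1 i)); rewrite -mulmxA a1x mulmxA.
  by apply/eqmx_sym/eqmxMr/std_blockU; [exact: blockU_trC|exact: ltn_ord].
- move=> i; apply/eqmxP; rewrite /flag_act trmxK mulmx1.
  apply: eqmx_trans (eqmxMr _ (aF2 i)); rewrite -mulmxA a2x.
  by apply/eqmx_sym/std_blockU; [exact: xL|exact: ltn_ord].
Qed.

(** Pair [F] with the standard flag. The group element takes the latter to a real flag with basis
    [o]; undoing [o] gives a stabilizer of the standard flag, hence an element of L, and keeps the
    first flag real. *)
Lemma flag_pairs_translates : flag_pairs ns ms -> flag_translates ns ms.
Proof.
move=> P F Ff.
have [g [E1 [E2 [gU E1r E2r gE1 gE2]]]] := P _ _ Ff (std_is_flag nsn (unitarymx1 _ _)).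
have [o oO oE] := is_real_flag_basis nsn E2r.
have oU : o \is unitarymx by case/andP: oO.
have oO' := orthmx_trC oO.
exists (g^T *m o^t*)^T, (fun i => E1 i *m o^t*); split.
- apply/blockU_tr/(stabilizer_blockU nsn).
    exact: mul_unitarymx (unitarymx_tr gU) (unitarymx_trC oU).
  move=> i; have /eqmxP := gE2 i; rewrite /flag_act mulmx1 => E.
  rewrite mulmxA; apply: eqmx_trans (eqmxMr _ (eqmx_sym E)) _.
  apply: eqmx_trans (eqmxMr _ (eqmx_sym (oE i))) _.
  by rewrite -mulmxA (unitarymxP oU) mulmx1.
- exact: is_real_flag_orth oO' E1r.
- move=> i; rewrite /flag_act trmxK mulmxA; apply/eqmxP/eqmxMr/eqmxP; exact: gE1.
Qed.

(** Translate the flag with basis [g^t*] to a real one, with basis [o]. Then [g^t* x^T o^t*]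
    stabilizes the standard flag, so it lies in H, and solving for [g] gives the factorization. *)
Lemma flag_translates_decomposes : flag_translates ns ms -> decomposes ns ms.
Proof.
move=> T g gU.
have [x [E [xL Er xE]]] := T _ (std_is_flag msn (unitarymx_trC gU)).
have [o oO oE] := is_real_flag_basis msn Er.
have oU : o \is unitarymx by case/andP: oO.
have xU : x^T \is unitarymx by case/andP: (blockU_tr xL).
have hH : blockU ms (g^t* *m x^T *m o^t*).
  apply: (stabilizer_blockU msn).
    exact: mul_unitarymx (mul_unitarymx (unitarymx_trC gU) xU) (unitarymx_trC oU).
  move=> i; have /eqmxP := xE i; rewrite /flag_act => {}xE.
  rewrite !mulmxA; apply: eqmx_trans (eqmxMr _ (eqmx_sym xE)) _.
  apply: eqmx_trans (eqmxMr _ (eqmx_sym (oE i))) _.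
  by rewrite -mulmxA (unitarymxP oU) mulmx1.
exists x^T, (o^t*), ((g^t* *m x^T *m o^t*)^t*); split.
- exact: blockU_tr.
- exact: orthmx_trC oO.
- exact: blockU_trC hH.
- rewrite !trmxC_mul !trmxCK -[_ *m _ *m (o *m _)]mulmxA [o^t* *m _]mulmxA.
  by rewrite (unitarymx_trK oU) mul1mx mulmxA (unitarymxP xU) mul1mx.
Qed.

End Equivalences.

(** * Compressing a factorization to selected coordinates *)

Lemma perm_extending (T : finType) r (f1 f2 : 'I_r -> T) :
  injective f1 -> injective f2 -> exists s : {perm T}, forall j, s (f1 j) = f2 j.
Proof.
move=> f1I f2I.
suff: forall d, (d <= r)%N -> exists s : {perm T}, forall j : 'I_r, (j < d)%N -> s (f1 j) = f2 j.
  by move=> /(_ r (leqnn r))[s sE]; exists s => j; apply: sE.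
elim=> [|d IHd] dr; first by exists 1%g.
have [s sE] := IHd (ltnW dr); pose i := Ordinal dr.
(* The transposition corrects the image of [f1 i] and fixes the images already placed. *)
exists (s * tperm (s (f1 i)) (f2 i))%g => j; rewrite ltnS leq_eqVlt permM.
move=> /predU1P[ji|jd]; first by rewrite (_ : j = i) ?tpermL //; apply: val_inj.
have ij : i != j by rewrite -(inj_eq val_inj) /= gtn_eqF.
have sij : s (f1 i) != s (f1 j) by rewrite (inj_eq (@perm_inj _ s)) (inj_eq f1I).
by rewrite tpermD // sE // (inj_eq f2I).
Qed.

Section Compression.
Variable C : numClosedFieldType.

Lemma blockwise_color_proj n c (x : 'M[C]_n) a :
  blockwise c x -> x *m color_proj C c a = color_proj C c a *m x.
Proof.
move=> xc; apply/matrixP => i j; rewrite mul_mx_diag mul_diag_mx !mxE mulrC.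
by have [->//|/xc ->] := eqVneq (c i) (c j); rewrite !mulr0.
Qed.

Definition selection n r (f : 'I_r -> 'I_n) : 'M[C]_(n, r) :=
  \matrix_(i, j) (i == f j)%:R.

(** [X] acts by [x] on the coordinates chosen by [f] and by a real diagonal matrix on the rest. For
    injective [f] the form is stable under products and adjoints, and the traces of [X] and [x]
    differ by a real number. *)
Definition splits n r (f : 'I_r -> 'I_n) (X : 'M[C]_n) (x : 'M[C]_r) :=
  exists d : 'rV[C]_n, [/\ d \is a realmx, forall j, d 0 (f j) = 0
    & X = selection f *m x *m (selection f)^T + diag_mx d].

Variables (n r : nat) (f : 'I_r -> 'I_n).
Hypothesis fI : injective f.
Local Notation E := (selection f).

Lemma tr_selectionK : E^T *m E = 1%:M.
Proof.
apply/matrixP => i j; rewrite !mxE (bigD1 (f i)) //= !mxE eqxx mul1r (inj_eq fI).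
by rewrite big1 ?addr0 // => k ki; rewrite !mxE (negPf ki) mul0r.
Qed.

Lemma diag_mul_selection (d : 'rV[C]_n) : (forall j, d 0 (f j) = 0) -> diag_mx d *m E = 0.
Proof.
move=> d0; apply/matrixP => i j; rewrite mul_diag_mx !mxE.
by have [->|_] := eqVneq i (f j); rewrite ?d0 ?mul0r ?mulr0.
Qed.

Lemma selection_mul_diag (d : 'rV[C]_n) : (forall j, d 0 (f j) = 0) -> E^T *m diag_mx d = 0.
Proof.
by move=> d0; rewrite -[LHS]trmxK trmx_mul trmxK tr_diag_mx diag_mul_selection ?trmx0.
Qed.

Lemma selection_mul_tr : E *m E^T = diag_mx (\row_i (i \in codom f)%:R).
Proof.
apply/matrixP => i k; rewrite !mxE; have [/codomP[j ->]|ni] := boolP (i \in codom f).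
  rewrite (bigD1 j) //= !mxE eqxx mul1r big1 ?addr0; first by rewrite eq_sym; case: eqP.
  by move=> l lj; rewrite !mxE (inj_eq fI) eq_sym (negPf lj) mul0r.
rewrite mul0rn big1 // => j _; rewrite !mxE; case: eqP => [ij|]; last by rewrite mul0r.
by rewrite ij codom_f in ni.
Qed.

Lemma mul_split_form (d e : 'rV[C]_n) x y :
  (forall j, d 0 (f j) = 0) -> (forall j, e 0 (f j) = 0) ->
  (E *m x *m E^T + diag_mx d) *m (E *m y *m E^T + diag_mx e) =
  E *m (x *m y) *m E^T + diag_mx (\row_i (d 0 i * e 0 i)).
Proof.
move=> d0 e0; rewrite mulmxDl !mulmxDr -!mulmxA selection_mul_diag // !mulmx0 addr0.
rewrite !(mulmxA (diag_mx d)) diag_mul_selection // !mul0mx add0r.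
by rewrite (mulmxA E^T E) tr_selectionK mul1mx mulmx_diag.
Qed.

Lemma splitsM X Y x y : splits f X x -> splits f Y y -> splits f (X *m Y) (x *m y).
Proof.
move=> [d [dr d0 ->]] [e [er e0 ->]]; exists (\row_i (d 0 i * e 0 i)); split.
- by apply/mxOverP => i j; rewrite mxE rpredM ?(mxOverP dr) ?(mxOverP er).
- by move=> j; rewrite mxE d0 mul0r.
- exact: mul_split_form.
Qed.

Lemma tr_split_form (d : 'rV[C]_n) x : d \is a realmx ->
  (E *m x *m E^T + diag_mx d)^t* = E *m x^t* *m E^T + diag_mx d.
Proof.
move=> dr; rewrite linearD map_mxD /= !trmxC_mul.
have Er : E \is a realmx by apply/mxOverP => i j; rewrite mxE realn.
rewrite (realmx_trC Er) realmx_trC ?realmx_tr // trmxK mulmxA.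
by rewrite tr_diag_mx map_diag_mx (realmxC dr).
Qed.

Lemma splits_trC X x : splits f X x -> splits f (X^t*) (x^t*).
Proof.
by move=> [d [dr d0 ->]]; exists d; split=> //; apply: tr_split_form.
Qed.

Lemma splits_color_proj c a : splits f (color_proj C c a) (color_proj C (c \o f) a).
Proof.
exists (\row_i ((c i == a) && (i \notin codom f))%:R); split.
- by apply/mxOverP => i j; rewrite mxE realn.
- by move=> j; rewrite mxE codom_f andbF.
have -> : E *m color_proj C (c \o f) a = color_proj C c a *m E.
  apply/matrixP => i j; rewrite mul_mx_diag mul_diag_mx !mxE mulrC.
  by have [->//|] := eqVneq i (f j); rewrite !mulr0.
rewrite -mulmxA selection_mul_tr mulmx_diag -linearD; congr diag_mx.
by apply/rowP => i; rewrite !mxE; case: (c i == a); case: (i \in _);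
  rewrite ?mulr1 ?mul1r ?mulr0 ?addr0 ?add0r.
Qed.

Lemma splits_trace X x : splits f X x -> \tr X \is Num.real -> \tr x \is Num.real.
Proof.
move=> [d [dr _ ->]]; rewrite linearD /= mxtrace_mulC mulmxA tr_selectionK mul1mx mxtrace_diag.
by rewrite rpredDr //; apply: rpred_sum => i _; apply: (mxOverP dr).
Qed.

Lemma splits_unitary (g : 'M[C]_r) : g \is unitarymx ->
  exists2 G : 'M[C]_n, G \is unitarymx & splits f G g.
Proof.
(* [g] is extended by the identity on the coordinates outside the image of [f]. *)
move=> gU; pose e : 'rV[C]_n := \row_i (i \notin codom f)%:R.
have er : e \is a realmx by apply/mxOverP => i j; rewrite mxE realn.
have e0 j : e 0 (f j) = 0 by rewrite mxE codom_f.
pose G := E *m g *m E^T + diag_mx e.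
have GS : splits f G g by exists e.
exists G => //; apply/unitarymxP.
rewrite tr_split_form // mul_split_form // (unitarymxP gU) mulmx1 selection_mul_tr -linearD /=.
apply/matrixP => i j; rewrite !mxE -natrM -natrD.
by case: (i \in _).
Qed.

End Compression.

Section Compress.
Variable C : numClosedFieldType.

Lemma splitsZ n r (f : 'I_r -> 'I_n) k (X : 'M[C]_n) x :
  k \is Num.real -> splits f X x -> splits f (k *: X) (k *: x).
Proof.
move=> kr [d [dr d0 ->]]; exists (k *: d); split.
- exact: realmxZ.
- by move=> j; rewrite mxE d0 mulr0.
- rewrite scalerDr -scalemxAr -scalemxAl; congr (_ + _).
  by apply/matrixP => i j; rewrite !mxE mulrnAr.
Qed.

Lemma splits_perm n r (f1 f2 : 'I_r -> 'I_n) (s : 'S_n) (X : 'M[C]_n) x :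
  (forall j, s (f1 j) = f2 j) -> splits f2 X x ->
  splits f1 (perm_mx s *m X *m (perm_mx s)^T) x.
Proof.
move=> sE [d [dr d0 ->]]; exists (\row_i d 0 (s i)); split.
- by apply/mxOverP => i j; rewrite mxE (mxOverP dr).
- by move=> j; rewrite mxE sE.
have sel : perm_mx s *m selection C f2 = selection C f1.
  by apply/matrixP => i j; rewrite -row_permE !mxE -sE (inj_eq (@perm_inj _ s)).
rewrite mulmxDr mulmxDl; congr (_ + _).
  by rewrite -sel trmx_mul !mulmxA.
rewrite tr_perm_mx -row_permE -col_permE; apply/matrixP => i j.
by rewrite !mxE (inj_eq (@perm_inj _ s)).
Qed.

Definition factors n (c1 c2 : 'I_n -> nat) (g : 'M[C]_n) :=
  exists x o h : 'M[C]_n, [/\ x \is unitarymx /\ blockwise c1 x,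
    o \is unitarymx /\ o \is a realmx, h \is unitarymx /\ blockwise c2 h
    & g = x *m o *m h].

(** [S] collects the matrices [A] that extend, as in [splits], to some [W] with [x^t* W x] real,
    where [x o h] factors the extended [g]. Since [x] commutes with the projections for [c1] and [h]
    with those for [c2], both families belong to [S]; conjugation by [x] does not change traces. *)
Lemma compression n r (c1 c2 : 'I_n -> nat) (f1 f2 : 'I_r -> 'I_n) (g : 'M[C]_r) :
  injective f1 -> injective f2 -> g \is unitarymx ->
  (forall G : 'M[C]_n, G \is unitarymx -> factors c1 c2 G) ->
  exists S : 'M[C]_r -> Prop, [/\
    (forall A B, S A -> S B -> S (A *m B)) /\
      (forall k A, k \is Num.real -> S A -> S (k *: A)),
    forall a, S (color_proj C (c1 \o f1) a),
    forall b, S (g *m color_proj C (c2 \o f2) b *m g^t*)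
    & forall A, S A -> \tr A \is Num.real].
Proof.
(* The permutation makes the extension of [g] read its rows through [f1] and its columns through
   [f2]. *)
move=> f1I f2I gU fact; have [s sE] := perm_extending f1I f2I.
have [G GU GS] := splits_unitary f2I gU.
have sr : (perm_mx s : 'M[C]_n) \is a realmx.
  by apply/mxOverP => i j; rewrite !mxE realn.
have sU : (perm_mx s : 'M[C]_n) \is unitarymx.
  by apply/unitarymxP; rewrite (realmx_trC sr) tr_perm_mx -perm_mxM mulgV perm_mx1.
have cr (c : 'I_n -> nat) a : color_proj C c a \is a realmx.
  by apply/mxOverP => i j; rewrite !mxE -mulrnA realn.
have [x [o [h [[xU xc] [oU or] [hU hc] gE]]]] := fact _ (mul_unitarymx sU GU).
have xK : x^t* *m x = 1%:M := unitarymx_trK xU.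
exists (fun A => exists W : 'M[C]_n, x^t* *m W *m x \is a realmx /\ splits f1 W A).
split; [split|..].
- move=> A B [W [Wr WA]] [Y [Yr YB]]; exists (W *m Y); split; last exact: splitsM.
  have -> : x^t* *m (W *m Y) *m x = (x^t* *m W *m x) *m (x^t* *m Y *m x).
    by rewrite !mulmxA -[_ *m x *m _]mulmxA (unitarymxP xU) mulmx1.
  exact: realmxM.
- move=> k A kr [W [Wr WA]]; exists (k *: W); split; last exact: splitsZ.
  by rewrite -scalemxAr -scalemxAl; apply: realmxZ.
- move=> a; exists (color_proj C c1 a); split; last exact: splits_color_proj.
  by rewrite -mulmxA -blockwise_color_proj // mulmxA xK mul1mx.
- move=> b; pose Q := color_proj C c2 b.
  exists ((perm_mx s *m G) *m Q *m (perm_mx s *m G)^t*); split.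
    rewrite gE !trmxC_mul !mulmxA xK mul1mx -[_ *m x]mulmxA xK mulmx1.
    rewrite -[o *m h *m Q]mulmxA blockwise_color_proj // -/Q mulmxA.
    rewrite -[o *m Q *m h *m _]mulmxA (unitarymxP hU) mulmx1 (realmx_trC or).
    exact: realmxM (realmxM or (cr _ _)) (realmx_tr or).
  have -> : perm_mx s *m G *m Q *m (perm_mx s *m G)^t* =
      perm_mx s *m (G *m Q *m G^t*) *m (perm_mx s)^T.
    by rewrite trmxC_mul (realmx_trC sr) !mulmxA.
  apply: (splits_perm sE); apply: (splitsM f2I _ (splits_trC GS)).
  refine (splitsM f2I GS _); exact: splits_color_proj.
- move=> A [W [Wr WA]]; apply: (splits_trace f1I WA).
  have <- : \tr (x^t* *m W *m x) = \tr W.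
    by rewrite mxtrace_mulC mulmxA (unitarymxP xU) mul1mx.
  exact: realmx_trace.
Qed.

End Compress.

(** * Exact arithmetic with Gaussian integer matrices *)

Definition gauss := (Z * Z)%type.
Definition gauss0 : gauss := (Z0, Z0).
Definition gadd (u v : gauss) : gauss := (Z.add u.1 v.1, Z.add u.2 v.2).
Definition gmul (u v : gauss) : gauss :=
  (Z.sub (Z.mul u.1 v.1) (Z.mul u.2 v.2), Z.add (Z.mul u.1 v.2) (Z.mul u.2 v.1)).
Definition gconj (u : gauss) : gauss := (u.1, Z.opp u.2).

(* Gaussian-integer matrices as lists of rows, so that matrix identities and
   traces can be evaluated by the kernel. *)
Definition glist := seq (seq gauss).
Definition gentry (L : glist) i j := nth gauss0 (nth [::] L i) j.
Definition gmatrix r (F : nat -> nat -> gauss) : glist :=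
  mkseq (fun i => mkseq (F i) r) r.
Definition gsum r (F : nat -> gauss) := foldr (fun k => gadd (F k)) gauss0 (iota 0 r).
Definition glmul r (L K : glist) : glist :=
  gmatrix r (fun i j => gsum r (fun k => gmul (gentry L i k) (gentry K k j))).
Definition glconj r (L : glist) : glist := gmatrix r (fun i j => gconj (gentry L j i)).
Definition gscalar r (u : gauss) : glist :=
  gmatrix r (fun i j => if i == j then u else gauss0).
Definition gproj r (c : nat -> nat) a : glist :=
  gmatrix r (fun i j => if (i == j) && (c i == a) then (Zpos 1, Z0) else gauss0).
Definition gtrace r (L : glist) := gsum r (fun i => gentry L i i).

Section GaussianMatrices.
Variable C : numClosedFieldType.

Definition gval (u : gauss) : C := (int_of_Z u.1)%:~R + 'i * (int_of_Z u.2)%:~R.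

Definition gmx r (L : glist) : 'M[C]_r := \matrix_(i, j) gval (gentry L i j).

Lemma gentry_gmatrix r F i j : (i < r)%N -> (j < r)%N -> gentry (gmatrix r F) i j = F i j.
Proof. by move=> ir jr; rewrite /gentry !nth_mkseq. Qed.

Lemma gval0 : gval gauss0 = 0.
Proof. by rewrite /gval /= mulr0 addr0. Qed.

Lemma gvalD u v : gval (gadd u v) = gval u + gval v.
Proof.
rewrite /gval /= (rmorphD int_of_Z u.1) (rmorphD int_of_Z u.2) !intrD mulrDr; ring.
Qed.

Lemma gvalM u v : gval (gmul u v) = gval u * gval v.
Proof.
rewrite /gval /= (rmorphB int_of_Z (u.1 * v.1) (u.2 * v.2)).
rewrite (rmorphD int_of_Z (u.1 * v.2) (u.2 * v.1)) !rmorphM /= !(intrB, intrD, intrM).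
have ii : 'i * 'i = -1 :> C by rewrite -expr2 sqrCi.
by ring: ii.
Qed.

Lemma gval_conj u : gval (gconj u) = (gval u)^*.
Proof.
rewrite /gval /= (rmorphN int_of_Z u.2) rmorphD rmorphM /= conjCi !rmorph_int mulNr.
by rewrite intrN mulrN.
Qed.

Lemma gval_sum r F : gval (gsum r F) = \sum_(k < r) gval (F k).
Proof.
rewrite -(big_mkord xpredT (fun k => gval (F k))) /gsum /index_iota subn0.
by elim: (iota 0 r) => [|k s IHs] /=; rewrite ?big_nil ?gval0 // big_cons gvalD IHs.
Qed.

Lemma gmx_mul r L K : gmx r L *m gmx r K = gmx r (glmul r L K).
Proof.
apply/matrixP => i j; rewrite !mxE gentry_gmatrix // gval_sum.
by apply: eq_bigr => k _; rewrite !mxE gvalM.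
Qed.

Lemma gmx_trC r L : (gmx r L)^t* = gmx r (glconj r L).
Proof. by apply/matrixP => i j; rewrite !mxE gentry_gmatrix // gval_conj. Qed.

Lemma gmx_scalar r u : gmx r (gscalar r u) = (gval u)%:M.
Proof.
apply/matrixP => i j; rewrite !mxE gentry_gmatrix // (inj_eq val_inj).
by case: eqP => _; rewrite ?gval0.
Qed.

Lemma gmx_proj r (c : nat -> nat) a : gmx r (gproj r c a) = color_proj C (fun i : 'I_r => c i) a.
Proof.
apply/matrixP => i j; rewrite !mxE gentry_gmatrix // (inj_eq val_inj).
have [_|_] := eqVneq i j; rewrite ?gval0 //= mulr1n.
by case: eqP => _; rewrite ?gval0 // /gval /= mulr0 addr0.
Qed.

Lemma gmx_trace r L : \tr (gmx r L) = gval (gtrace r L).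
Proof. by rewrite gval_sum; apply: eq_bigr => i _; rewrite mxE. Qed.

Lemma gval_real u : gval u \is Num.real -> u.2 = Z0.
Proof.
move=> /Creal_ImP; rewrite /gval raddfD /= ImMil (elimT (Creal_ImP _)) ?realz //.
rewrite (elimT (Creal_ReP _)) ?realz // add0r => /eqP; rewrite intr_eq0 => /eqP.
by rewrite -[0%R]/(int_of_Z Z0) => /(can_inj int_of_ZK).
Qed.

(** [inl a] is a projection for [c1], and [inr b] is one for [c2] conjugated by [L]. When [L] is [t]
    times a unitary matrix the latter carries a factor [t^2], which keeps all entries integral. *)
Definition gletter r c1 c2 L (l : nat + nat) : glist := match l with
  | inl a => gproj r c1 a
  | inr b => glmul r (glmul r L (gproj r c2 b)) (glconj r L)
  end.

Definition gword r c1 c2 L l w :=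
  foldl (fun K l' => glmul r K (gletter r c1 c2 L l')) (gletter r c1 c2 L l) w.

(** [L / t] is unitary and the factors [t^2] in the letters are real, so [compression] puts every
    word in a set of matrices with real trace. *)
Lemma word_obstruction n r (c1 c2 : 'I_n -> nat) (f1 f2 : 'I_r -> 'I_n)
    (d1 d2 : nat -> nat) (t : Z) L l w :
  injective f1 -> injective f2 ->
  (forall j, c1 (f1 j) = d1 j) -> (forall j, c2 (f2 j) = d2 j) ->
  t != Z0 -> glmul r L (glconj r L) = gscalar r (Z.mul t t, Z0) ->
  (forall G : 'M[C]_n, G \is unitarymx -> factors c1 c2 G) ->
  (gtrace r (gword r d1 d2 L l w)).2 = Z0.
Proof.
move=> f1I f2I cf1 cf2 t0 LU fact; apply: gval_real; rewrite -gmx_trace.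
pose k : C := (int_of_Z t)%:~R.
have kr : k \is Num.real by rewrite realz.
have k0 : k != 0.
  by rewrite intr_eq0 -[0%R]/(int_of_Z Z0) (inj_eq (can_inj int_of_ZK)).
have kV : (k^-1)^* = k^-1 by apply: conj_Creal; rewrite rpredV.
pose g := k^-1 *: gmx r L.
have gU : g \is unitarymx.
  apply/unitarymxP; rewrite trmxC_scale kV -scalemxAl -scalemxAr scalerA gmx_trC gmx_mul LU.
  rewrite gmx_scalar scale_scalar_mx /gval /= mulr0 addr0 (rmorphM int_of_Z t t) intrM -/k.
  by congr _%:M; field.
have [S [[SM SZ] S1 S2 Sr]] := compression f1I f2I gU fact.
have Sl l' : S (gmx r (gletter r d1 d2 L l')).
  case: l' => a /=.
    rewrite gmx_proj (_ : color_proj _ _ _ = color_proj C (c1 \o f1) a) //.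
    by congr diag_mx; apply/rowP => j; rewrite !mxE /= cf1.
  have := SZ (k * k) _ (rpredM kr kr) (S2 a).
  rewrite trmxC_scale kV -!scalemxAl -scalemxAr !scalerA mulfK // mulfV // scale1r.
  rewrite gmx_trC (_ : color_proj _ _ _ = gmx r (gproj r d2 a)) ?gmx_mul //.
  by rewrite gmx_proj; congr diag_mx; apply/rowP => j; rewrite !mxE /= cf2.
apply: Sr; rewrite /gword; elim/last_ind: w => [|w l' IHw] /=; first exact: Sl.
by rewrite foldl_rcons -gmx_mul; apply: SM (Sl _).
Qed.

End GaussianMatrices.

(** * Positions inside blocks, and smallest parts *)

Lemma block_positions s d r : (0 < d)%N ->
  (forall a, (a * d < r)%N -> (a < size s)%N && (d <= nth 0 s a)%N) ->
  exists2 f : 'I_r -> 'I_(sumn s), injective f & forall j, blk s (f j) = (j %/ d)%N.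
Proof.
move=> d0 sd.
(* Index [j] is placed at offset [j %% d] of block [j %/ d]. *)
have pos (j : 'I_r) : exists i : 'I_(sumn s),
    val i = (sumn (take (j %/ d) s) + j %% d)%N /\ blk s i = (j %/ d)%N.
  have /sd/andP[js jd] : (j %/ d * d < r)%N by apply: leq_ltn_trans (leq_divM _ _) _.
  have [bE lt] := blk_offset js (leq_trans (ltn_pmod j d0) jd).
  by exists (Ordinal lt).
have [f fP] := fin_all_exists pos; exists f => [i j ij|j]; last by case: (fP j).
apply: val_inj; rewrite /= (divn_eq i d) (divn_eq j d).
have [Ei Bi] := fP i; have [Ej Bj] := fP j; rewrite ij in Ei Bi.
rewrite -Bi -Bj; congr (_ + _)%N.
by apply/eqP; rewrite -(eqn_add2l (sumn (take (j %/ d) s))) -Ej Ei -Bi -Bj.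
Qed.

Lemma blk_bounds s i : (i < sumn s)%N ->
  (sumn (take (blk s i) s) <= i < sumn (take (blk s i).+1 s))%N.
Proof.
move=> lt; have bs := blk_size lt; rewrite -blk_leq // leqnn andbT.
case E : (blk s i) bs => [|b] bs; first by rewrite take0.
by rewrite leqNgt -blk_leq ?(ltnW bs) // E ltnn.
Qed.

Lemma minpart_leq s a : (a < size s)%N -> (minpart s <= nth 0 s a)%N.
Proof.
rewrite /minpart; elim: s (head _ _) a => //= x s IHs h [_|a lt]; rewrite geq_min ?leqnn //.
by rewrite IHs ?orbT.
Qed.

Lemma minpart_nth s : (0 < size s)%N -> exists2 a, (a < size s)%N & nth 0%N s a = minpart s.
Proof.
rewrite /minpart => s0; have : head 0%N s \in s by case: s s0 => //= x s _; rewrite mem_head.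
suff : forall h, h \in s -> foldr minn h s \in s.
  by move=> H /H /(nthP 0%N)[a lt E]; exists a.
(* The seed of the fold is the head of the whole list, so the induction runs over a separate sublist
   [t]. *)
have sub t : {subset t <= s} -> forall h, h \in s -> foldr minn h t \in s.
  elim: t => //= x t IHt ts h hs; rewrite /minn; case: ifP => _.
    by apply: ts; rewrite mem_head.
  by apply: IHt => // y yt; apply: ts; rewrite inE yt orbT.
exact: sub.
Qed.

(** * Explicit matrices that obstruct the factorization *)

Section Obstructions.
Variable C : numClosedFieldType.

(** The rows of the pattern are cut into pieces of length [d1] and its columns into pieces of length
    [d2], placed in the first blocks of [ns] and [ms]; a last piece may be shorter. *)
Lemma block_obstruction n ns ms d1 d2 r (t : Z) L l w :
  sumn ns = n -> sumn ms = n -> (0 < d1)%N -> (0 < d2)%N ->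
  (forall a, (a * d1 < r)%N -> (a < size ns)%N && (d1 <= nth 0 ns a)%N) ->
  (forall a, (a * d2 < r)%N -> (a < size ms)%N && (d2 <= nth 0 ms a)%N) ->
  t != Z0 -> glmul r L (glconj r L) = gscalar r (Z.mul t t, Z0) ->
  (gtrace r (gword r (divn^~ d1) (divn^~ d2) L l w)).2 != Z0 ->
  ~ forall G : 'M[C]_n, G \is unitarymx ->
      factors (fun i : 'I_n => blk ns i) (fun i : 'I_n => blk ms i) G.
Proof.
move=> <- nm d10 d20 /block_positions-/(_ d10)[f1 f1I f1E].
move=> /block_positions-/(_ d20); rewrite nm => -[f2 f2I f2E] t0 LU /eqP tr0 fact; apply: tr0.
exact: (@word_obstruction C _ r _ _ f1 f2 (divn^~ d1) (divn^~ d2) t L l w f1I f2I f1E f2E t0 LU fact).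
Qed.

Delimit Scope Z_scope with coq_Z.

(** The word [D0 P0 D1 P1], with [P_b] the conjugate of [D_b] by [L], has trace [L00 L11] times the
    conjugate of [L10 L01]. For the matrix below, 4 times a unitary one, this is [16 i]. *)
Lemma three_by_three n ns ms : sumn ns = n -> sumn ms = n ->
  (2 < size ns)%N -> (2 < size ms)%N -> (0 < minpart ns)%N -> (0 < minpart ms)%N ->
  ~ forall G : 'M[C]_n, G \is unitarymx ->
      factors (fun i : 'I_n => blk ns i) (fun i : 'I_n => blk ms i) G.
Proof.
move=> nn mn k3 l3 N0 M0.
pose L : glist := [:: [:: (2, 2); (2, 0); (-2, 0)];
                      [:: (2, 0); (1, 1); (3, -1)];
                      [:: (2, 0); (-3, 1); (-1, -1)]]%coq_Z.
apply: (@block_obstruction n ns ms 1 1 3 4%coq_Z L (inl 0%N) [:: inr 0%N; inl 1%N; inr 1%N]) => //.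
- move=> a a3; have as_ : (a < size ns)%N by lia.
  by rewrite as_ (leq_trans N0) ?minpart_leq.
- move=> a a3; have as_ : (a < size ms)%N by lia.
  by rewrite as_ (leq_trans M0) ?minpart_leq.
Qed.

(** With [P] built from the first two columns of [L], the word [D0 P D1 P D2 P] has trace
    [P01 P12 P20]. A single column would always give a real product; the two columns below give
    [108 + 24 i]. *)
Lemma four_by_two n ns ms : sumn ns = n -> sumn ms = n ->
  (3 < size ns)%N -> (1 < size ms)%N -> (0 < minpart ns)%N -> (1 < minpart ms)%N ->
  ~ forall G : 'M[C]_n, G \is unitarymx ->
      factors (fun i : 'I_n => blk ns i) (fun i : 'I_n => blk ms i) G.
Proof.
move=> nn mn k4 l2 N0 M1.
pose L : glist := [:: [:: (2, 0); (1, 0); (-1, -3); (0, -1)];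
                      [:: (2, 0); (0, 1); (1, 1); (-3, 0)];
                      [:: (2, 0); (2, 0); (0, 2); (2, 0)];
                      [:: (2, 0); (-3, -1); (0, 0); (1, 1)]]%coq_Z.
apply: (@block_obstruction n ns ms 1 2 4 4%coq_Z L (inl 0%N)
  [:: inr 0%N; inl 1%N; inr 0%N; inl 2%N; inr 0%N]) => //.
- move=> a a4; have as_ : (a < size ns)%N by lia.
  by rewrite as_ (leq_trans N0) ?minpart_leq.
- move=> a a4; have as_ : (a < size ms)%N by lia.
  by rewrite as_ (leq_trans M1) ?minpart_leq.
Qed.

(* Columns 0, 1, 4, 5 rotate the first two columns of the 4 x 4 matrix above
   against two new coordinates by the 3-4-5 angle; the scale is 20.  With
   [A_a = V^* D_a V], [V] being columns 0, 1, 2, the word below has the trace of [A0 A0 A1 A0 A1 A1]. *)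
Lemma three_by_two n ns ms : sumn ns = n -> sumn ms = n ->
  (2 < size ns)%N -> (1 < size ms)%N -> (1 < minpart ns)%N -> (2 < minpart ms)%N ->
  ~ forall G : 'M[C]_n, G \is unitarymx ->
      factors (fun i : 'I_n => blk ns i) (fun i : 'I_n => blk ms i) G.
Proof.
move=> nn mn k3 l2 N1 M2.
pose L : glist :=
  [:: [:: (16, 0); (0, 0); (0, 0); (0, 0); (12, 0); (0, 0)];
      [:: (0, 0); (12, 0); (0, 0); (0, 0); (0, 0); (16, 0)];
      [:: (6, 0); (4, 0); (-5, -15); (0, -5); (-8, 0); (-3, 0)];
      [:: (6, 0); (0, 4); (5, 5); (-15, 0); (-8, 0); (0, -3)];
      [:: (6, 0); (8, 0); (0, 10); (10, 0); (-8, 0); (-6, 0)];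
      [:: (6, 0); (-12, -4); (0, 0); (5, 5); (-8, 0); (9, 3)]]%coq_Z.
apply: (@block_obstruction n ns ms 2 3 6 20%coq_Z L (inr 0%N)
  [:: inl 0%N; inr 0%N; inl 0%N; inr 0%N; inl 1%N;
      inr 0%N; inl 0%N; inr 0%N; inl 1%N; inr 0%N; inl 1%N]) => //.
- move=> a a6; have as_ : (a < size ns)%N by lia.
  by rewrite as_ (leq_trans N1) ?minpart_leq.
- move=> a a6; have as_ : (a < size ms)%N by lia.
  by rewrite as_ (leq_trans M2) ?minpart_leq.
Qed.

End Obstructions.

(** * Arithmetic of condition (iii) *)

Definition exceptional k l N M :=
  [|| (k == 2) && (l == 2),
       [&& k == 3, N == 1 & l == 2],
       [&& k == 3, 2 <= N, l == 2 & M == 2],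
       (l == 2) && (M == 1),
       [&& k == 2, l == 3 & M == 1],
       [&& k == 2, N == 2, l == 3 & 2 <= M]
     | (k == 2) && (N == 1)]%N.

(** Regroups the list by which partition has two parts, the form that the constructions use. *)
Lemma exceptional_sufficient k l N M : (1 < k)%N -> (1 < l)%N -> (0 < N)%N -> (0 < M)%N ->
  exceptional k l N M ->
  [|| (l == 2) && [|| k == 2, (k == 3) && (N == 1), (k == 3) && (M == 2) | M == 1]
    | (k == 2) && [|| l == 2, (l == 3) && (M == 1), (l == 3) && (N == 2) | N == 1]]%N.
Proof.
rewrite /exceptional.
case: k => [|[|[|[|k]]]] // _; case: l => [|[|[|[|l]]]] // _;
by case: N => [|[|[|N]]] // _; case: M => [|[|[|M]]].
Qed.

(** The two triples are what the obstructions give for the pair of partitions and for the exchanged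
    pair. All comparisons are with constants up to 3, so finitely many cases decide the claim. *)
Lemma exceptional_necessary k l N M : (1 < k)%N -> (1 < l)%N -> (0 < N)%N -> (0 < M)%N ->
  [/\ (k == 2) || (l == 2), (3 < k) ==> (M == 1) & (k == 3) ==> (N == 1) || (M <= 2)]%N ->
  [/\ (l == 2) || (k == 2), (3 < l) ==> (N == 1) & (l == 3) ==> (M == 1) || (N <= 2)]%N ->
  exceptional k l N M.
Proof.
rewrite /exceptional.
case: k => [|[|[|[|k]]]] // _; case: l => [|[|[|[|l]]]] // _;
case: N => [|[|[|N]]] // _; case: M => [|[|[|M]]] // _; by move=> [? ? ?] [? ? ?].
Qed.

(** * Classification of the pairs of partitions *)

Section Classification.
Variables (R : realType) (n : nat).
Local Notation C := (Cx R).

Lemma decomposes_factors ns ms : decomposes R n ns ms ->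
  forall G : 'M[C]_n, G \is unitarymx ->
    factors (fun i : 'I_n => blk ns i) (fun i : 'I_n => blk ms i) G.
Proof.
move=> D G /D[x [o [h [/blockUP xL /andP oO /blockUP hH gE]]]].
by exists x, o, h; split.
Qed.

(** A two-step flag is one subspace, of dimension [m1] and codimension [m2], so [real_translate]
    applies with either number as [m]. A part equal to 1 supplies the singleton colour. *)
Lemma two_step_translates ns m1 m2 m : sumn ns = n -> (m1 + m2 = n)%N ->
  m = m1 \/ m = m2 ->
  [\/ (m <= 1)%N, (size ns <= 2)%N | (size ns <= 3)%N /\ ((m <= 2)%N \/ minpart ns = 1%N)] ->
  flag_translates R n ns [:: m1; m2].
Proof.
move=> nn mn mE H F [Fr Fle].
have r0 : \rank (F ord0) = m1 by rewrite Fr /= addn0.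
have r1 : \rank (F ord_max) = n by rewrite Fr /= addn0.
have mF : m = \rank (F ord0) \/ m = (n - \rank (F ord0))%N by rewrite r0; lia.
have ck (i : 'I_n) : (blk ns i < size ns)%N by rewrite blk_size // nn.
have [|y [yU yc [W Wr WE]]] := @real_translate C n (fun i => blk ns i) _ m (F ord0) mF ck.
  case: H => [m1'|k2|[k3 [m2'|N1]]]; [exact: Or31|exact: Or32|by apply: Or33; split; [|left]|].
  have [|k0] := leqP (size ns) 0; first by move=> k0; apply: Or32; lia.
  apply: Or33; split=> //; right; have [a an aE] := minpart_nth k0.
  have lt1 : (0 < nth 0 ns a)%N by rewrite aE N1.
  have [bE blt] := blk_offset an lt1; rewrite nn in blt.
  exists (Ordinal blt) => j /= jE; apply: val_inj => /=; rewrite bE in jE.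
  have := @blk_bounds ns j; rewrite nn ltn_ord jE (take_nth 0%N an) sumn_rcons aE N1 => /(_ isT).
  lia.
have yL : blockU ns y by apply/blockUP; split.
(* The second member of the flag is the whole space, with the identity as a real basis. *)
exists y^T, (fun i => if i == ord0 then W else 1%:M).
have E1 : (1%:M == F ord_max *m y)%MS.
  rewrite submx1 sub1mx /row_full mxrankMfree ?r1 ?eqxx //.
  by rewrite row_free_unit; apply: unitarymx_unit.
have EE (i : 'I_2) : ((if i == ord0 then W else 1%:M) == F i *m y)%MS.
  have [->|i0] := eqVneq i ord0; first exact: WE.
  by rewrite (_ : i = ord_max) //; case: i i0 => [[|[|]]] // ? ?; apply: val_inj.
have rE (i : 'I_2) : ((if i == ord0 then W else 1%:M) :=: F i *m y)%MS by apply/eqmxP.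
split; [exact: blockU_tr| |by move=> i; rewrite /flag_act trmxK; apply: EE].
split; first split.
- by move=> i; rewrite rE mxrankMfree ?Fr // row_free_unit; apply: unitarymx_unit.
- by move=> i j ij; rewrite !rE; apply/submxMr/Fle.
- move=> i; exists (if i == ord0 then W else 1%:M); rewrite !submx_refl !andbT.
  by case: ifP => _; [exact: Wr|exact: realmx1].
Qed.

Lemma two_step_decomposes ns ms : sumn ns = n -> sumn ms = n -> size ms = 2%N ->
  [|| size ns == 2, (size ns == 3) && (minpart ns == 1),
      (size ns == 3) && (minpart ms == 2) | minpart ms == 1]%N ->
  decomposes R n ns ms.
Proof.
move=> nn + s2; case: ms s2 => [|m1 [|m2 [|]]] //= _; rewrite addn0 => mn H.
apply: flag_translates_decomposes => //=; first by rewrite addn0.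
have [m mE mm] : exists2 m, m = m1 \/ m = m2 & m = minpart [:: m1; m2].
  by exists (minpart [:: m1; m2]) => //; rewrite /minpart /= /minn; do 2 case: ifP; auto; lia.
apply: (two_step_translates nn mn mE); rewrite mm.
case/or4P: H => [/eqP->|/andP[/eqP-> /eqP->]|/andP[/eqP-> /eqP->]|/eqP->];
  [exact: Or32|by apply: Or33; split=> //; right|by apply: Or33; split=> //; left|exact: Or31].
Qed.

Lemma decomposes_cases ns ms : sumn ns = n -> sumn ms = n ->
  (1 < size ns)%N -> (1 < size ms)%N -> (0 < minpart ns)%N -> (0 < minpart ms)%N ->
  decomposes R n ns ms ->
  [/\ (size ns == 2) || (size ms == 2),
      (3 < size ns) ==> (minpart ms == 1)
    & (size ns == 3) ==> (minpart ns == 1) || (minpart ms <= 2)]%N.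
Proof.
move=> nn mn k2 l2 N0 M0 /decomposes_factors D; split.
- case: eqP => //= k; case: eqP => //= l; exfalso.
  by apply: (three_by_three nn mn _ _ N0 M0 D); lia.
- apply/implyP => k; case: eqP => // M; exfalso.
  by apply: (four_by_two nn mn _ _ N0 _ D); lia.
- apply/implyP => /eqP k; case: eqP => //= N; rewrite leqNgt; apply/negP => M.
  by apply: (three_by_two nn mn _ _ _ M D); lia.
Qed.

End Classification.

Theorem theoremA (R : realType) (n : nat) (ns ms : seq nat) :
  (2 <= size ns)%N -> (2 <= size ms)%N ->
  all (fun x => 0 < x)%N ns -> all (fun x => 0 < x)%N ms ->
  sumn ns = n -> sumn ms = n ->
  let k := size ns in let l := size ms in
  let N := minpart ns in let M := minpart ms in
  [<->
   (* (i) G = L G' H *)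
   (forall g : 'M[Cx R]_n, g \is unitarymx ->
      exists x o h : 'M[Cx R]_n,
        [/\ blockU ns x, orthmx o, blockU ms h & g = x *m o *m h]);
   (* (ii) *)
   (forall (F1 : 'I_(size ms) -> 'M[Cx R]_n) (F2 : 'I_(size ns) -> 'M[Cx R]_n),
      is_flag F1 -> is_flag F2 ->
      exists g : 'M[Cx R]_n, exists (E1 : 'I_(size ms) -> 'M[Cx R]_n)
                                   (E2 : 'I_(size ns) -> 'M[Cx R]_n),
        [/\ g \is unitarymx, is_real_flag E1, is_real_flag E2,
            flag_eq E1 (flag_act g F1) & flag_eq E2 (flag_act g F2)]);
   (* (ii)' *)
   (forall F : 'I_(size ms) -> 'M[Cx R]_n, is_flag F ->
      exists x : 'M[Cx R]_n, exists E : 'I_(size ms) -> 'M[Cx R]_n,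
        [/\ blockU ns x, is_real_flag E & flag_eq E (flag_act x F)]);
   (* (ii)'' *)
   (forall F : 'I_(size ns) -> 'M[Cx R]_n, is_flag F ->
      exists h : 'M[Cx R]_n, exists E : 'I_(size ns) -> 'M[Cx R]_n,
        [/\ blockU ms h, is_real_flag E & flag_eq E (flag_act h F)]);
   (* (iii) *)
   [|| (k == 2) && (l == 2),
       [&& k == 3, N == 1 & l == 2],
       [&& k == 3, 2 <= N, l == 2 & M == 2],
       (l == 2) && (M == 1),
       [&& k == 2, l == 3 & M == 1],
       [&& k == 2, N == 2, l == 3 & 2 <= M]
     | (k == 2) && (N == 1)]%N : Prop
  ].
Proof.
move=> k2 l2 ns0 ms0 nn mn k l N M.
have minpart_gt0 s : (1 < size s)%N -> all (fun x => 0 < x)%N s -> (0 < minpart s)%N.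
  move=> s2 s0; have [|a an <-] := @minpart_nth s; first exact: ltnW.
  exact: (all_nthP 0%N s0).
have N0 : (0 < N)%N by apply: minpart_gt0.
have M0 : (0 < M)%N by apply: minpart_gt0.
tfae.
- exact: decomposes_flag_pairs.
- exact: flag_pairs_translates.
(* The passage from (ii)' to (ii)'' goes through (i), which is symmetric in the two partitions. *)
- move=> /(flag_translates_decomposes mn)/decomposes_sym D.
  exact/flag_pairs_translates/decomposes_flag_pairs.
(* The obstructions are applied to both orders of the partitions. *)
- move=> /(flag_translates_decomposes nn) D'.
  apply: exceptional_necessary => //.
    exact: (decomposes_cases nn mn k2 l2 N0 M0 (decomposes_sym D')).
  exact: (decomposes_cases mn nn l2 k2 M0 N0 D').
(* The partition with two parts provides the flags to be moved; if it is [ns], symmetry exchanges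
   the roles. *)
- case/(exceptional_sufficient k2 l2 N0 M0)/orP => /andP[/eqP s2 H].
    exact: (two_step_decomposes nn mn s2 H).
  exact: (decomposes_sym (two_step_decomposes mn nn s2 H)).
Qed.
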